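(* Let $X$ be any domain. For every concept $c\subseteq X$ and every hypothesis class $\mathcal{H}\subseteq 2^X$ with $\mathrm{VC}(X,\mathcal{H})<\infty$, exactly one of the following cases holds: (1) $c$ is not approximable by $\mathcal{H}$. (2) $c$ is approximable but not interpretable by $\mathcal{H}$. (3) $c$ is uniformly interpretable by $\mathcal{H}$ at constant depth rate. If $\mathrm{VC}(X,\mathcal{H})=\infty$, then exactly one of (1), (2), (3$'$) holds, where (3$'$) $c$ is uniformly interpretable by $\mathcal{H}$ at depth rate at most logarithmic. Moreover, all cases are nonempty: each of (1), (2), (3) occurs for some $X$, $c$, $\mathcal{H}$ with $\mathrm{VC}(X,\mathcal{H})<\infty$, and (3$'$) occurs for some $X$, $c$, $\mathcal{H}$ with $\mathrm{VC}(X,\mathcal{H})=\infty$.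
   Context: Fix a $\sigma$-algebra on $X$; $\mathcal{P}(X)$ is the set of all probability distributions on $X$ with this $\sigma$-algebra. The concept $c\subseteq X$ and all members of the hypothesis class $\mathcal{H}\subseteq 2^X$ are assumed measurable, and subsets of $X$ are identified with their indicator functions $X\to\{0,1\}$. $\mathrm{VC}(X,\mathcal{H})$ is the VC dimension. For classes of finite VC dimension, the standard measurability conditions are assumed under which the Vapnik–Chervonenkis uniform convergence theorem applies; in particular, it applies under every $P\in\mathcal{P}(X)$ to every class of finite VC dimension consisting of sets $T\triangle c$, with $T$ ranging over a subfamily of the classifiers computed by the $\mathcal{H}$-based decision trees defined next. An $\mathcal{H}$-based decision tree is a finite full binary tree $T$ in which every leaf holds a label in $\{0,1\}$ and every internal node $v$ holds a function $f_v\in\mathcal{H}$; a point $x$ is routed from the root to a leaf, going at node $v$ to the child determined by $f_v(x)$, and $T(x)$ is the label of the leaf reached. $\mathrm{depth}(T)$ is the height of $T$ (a single leaf has depth $0$). For $P\in\mathcal{P}(X)$ let $L_P(T,c)=\Pr_{x\sim P}(T(x)\neq c(x))$, and let $$\mathrm{depth}^c_{\mathcal{H}}(\varepsilon\mid P)=\inf\{\mathrm{depth}(T): T \text{ an } \mathcal{H}\text{-based decision tree with } L_P(T,c)\le\varepsilon\}\quad(\inf\emptyset=\infty).$$ $c$ is approximable by $\mathcal{H}$ if for every $P\in\mathcal{P}(X)$ and every $\varepsilon>0$ there exists an $\mathcal{H}$-based decision tree $T$ with $L_P(T,c)\le\varepsilon$. $c$ is interpretable by $\mathcal{H}$ if there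 is a function $f:(0,1]\to\mathbb{N}$ such that for every $P\in\mathcal{P}(X)$ there exists $\varepsilon_P>0$ with $\mathrm{depth}^c_{\mathcal{H}}(\varepsilon\mid P)\le f(\varepsilon)$ for all $0<\varepsilon\le\varepsilon_P$. $c$ is uniformly interpretable by $\mathcal{H}$ at depth rate $f':(0,1]\to\mathbb{N}$ if $\mathrm{depth}^c_{\mathcal{H}}(\varepsilon\mid P)\le f'(\varepsilon)$ for all $P\in\mathcal{P}(X)$ and all $0<\varepsilon\le 1$. The rate is constant if $f'$ can be taken to be a constant function (depending only on $c$ and $\mathcal{H}$), and at most logarithmic if $f'$ can be taken with $f'(\varepsilon)=O(\log(1/\varepsilon))$ as $\varepsilon\to0$. *)

(* Defs.v *)
From HB Require Import structures.
From mathcomp Require Import all_boot all_order all_algebra.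
From mathcomp Require Import all_classical all_reals all_analysis.

Set Implicit Arguments.
Unset Strict Implicit.
Unset Printing Implicit Defensive.

Import Order.TTheory GRing.Theory Num.Theory.
Import numFieldNormedType.Exports.

Local Open Scope classical_set_scope.
Local Open Scope ring_scope.

Definition shatters (X : Type) (H : set (set X)) (S : set X) : Prop :=
  forall B : set X, B `<=` S -> exists2 A, H A & A `&` S = B.

(* +oo when arbitrarily large finite sets are shattered; the empty class gets
   -oo, the supremum of the empty set. *)
Definition VC_dim (R : realType) (X : Type) (H : set (set X)) : \bar R :=
  ereal_sup [set (n%:R)%:E | n in
    [set n : nat | exists S : set X, (S #= `I_n)%card /\ shatters H S]].

Inductive dtree (X : Type) : Type :=
| Leaf of bool
| Node of set X & dtree X & dtree X.

Arguments Leaf {X} _.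
Arguments Node {X} _ _ _.

Fixpoint based_on (X : Type) (H : set (set X)) (T : dtree X) : Prop :=
  match T with
  | Leaf _ => True
  | Node A T1 T0 => [/\ H A, based_on H T1 & based_on H T0]
  end.

Fixpoint tree_eval (X : Type) (T : dtree X) (x : X) : bool :=
  match T with
  | Leaf b => b
  | Node A T1 T0 => if x \in A then tree_eval T1 x else tree_eval T0 x
  end.

Fixpoint depth (X : Type) (T : dtree X) : nat :=
  match T with
  | Leaf _ => 0%N
  | Node _ T1 T0 => (maxn (depth T1) (depth T0)).+1
  end.

Definition tree_set (X : Type) (T : dtree X) : set X := [set x | tree_eval T x].

Definition cons_pair (X : Type) (n : nat) (p : X * n.-tuple X) : n.+1.-tuple X :=
  [tuple of p.1 :: p.2].

Section iid.
Context d (X : measurableType d) (R : realType).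

Let measurable_cons_pair n :
  measurable_fun [set: X * n.-tuple X] (@cons_pair X n).
Proof. exact: measurable_cons. Qed.

HB.instance Definition _ n :=
  isMeasurableFun.Build _ _ _ _ (@cons_pair X n) (@measurable_cons_pair n).

Fixpoint iid (P : probability X R) (n : nat) : probability (n.-tuple X) R :=
  match n with
  | 0 => \d_([tuple] : 0.-tuple X)
  | m.+1 => distribution (P \x iid P m)%E (@cons_pair X m)
  end.

End iid.

Lemma iid_rectangle d (X : measurableType d) (R : realType)
    (P : probability X R) (n : nat) (A : 'I_n -> set X) :
  (forall i, measurable (A i)) ->
  iid P n [set s | forall i, A i (tnth s i)] = (\prod_(i < n) P (A i))%E.
Proof.
elim: n A => [A mA|n IH A mA].
  rewrite big_ord0 /= diracE mem_set//=; first by case.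
rewrite big_ord_recl -(IH (fun i => A (lift ord0 i)))//=.
rewrite /distribution /pushforward.
have mB : measurable
    [set s : n.-tuple X | forall i, A (lift ord0 i) (tnth s i)].
  rewrite (_ : [set s | _] =
    \bigcap_(i in [set: 'I_n]) (fun s : n.-tuple X => tnth s i) @^-1` A (lift ord0 i)).
    apply: fin_bigcap_measurable; first exact: finite_finset.
    move=> i _; rewrite -[X in measurable X]setTI.
    exact: (measurable_tnth i measurableT).
  by apply/seteqP; split => s /= h i => [_|]; exact: h.
rewrite -product_measure1E//; congr (_ _).
apply/seteqP; split => -[x t] /= h.
  by split => [|i]; [exact: (h ord0)|have := h (lift ord0 i); rewrite tnthS].
case: h => h0 h i; case: (unliftP ord0 i) => [j ->|->]; last exact: h0.
by rewrite tnthS; exact: h.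
Qed.

Definition empirical (R : realType) (X : Type) (n : nat) (s : n.-tuple X)
    (A : set X) : R :=
  (\sum_(i < n) \1_A (tnth s i)) / n%:R.

(* Deviations exceed [eps] with outer probability tending to 0; the outer
   measure is there because the union over [F] need not be measurable. *)
Definition uniform_convergence d (X : measurableType d) (R : realType)
    (P : probability X R) (F : set (set X)) : Prop :=
  forall eps : R, 0 < eps ->
    ((iid P n)^*)%mu
      [set s | exists2 A, F A & eps < `|empirical R s A - fine (P A)|]
    @[n --> \oo] --> 0%E.

(* [A `+` c] is the symmetric difference. *)
Definition VC_theorem_applies d (X : measurableType d) (R : realType)
    (c : set X) (H : set (set X)) : Prop :=
  forall (P : probability X R) (F : set (set X)),
    F `<=` [set tree_set T `+` c | T in based_on H] ->
    (VC_dim R F < +oo)%E ->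
    uniform_convergence P F.

Definition standing_assumptions d (X : measurableType d) (R : realType)
    (c : set X) (H : set (set X)) : Prop :=
  [/\ measurable c,
      forall A, H A -> measurable A &
      VC_theorem_applies R c H].

Definition loss d (X : measurableType d) (R : realType) (P : probability X R)
    (T : dtree X) (c : set X) : \bar R :=
  P [set x | tree_eval T x != (x \in c)].

Definition depth_rate d (X : measurableType d) (R : realType) (c : set X)
    (H : set (set X)) (eps : R) (P : probability X R) : \bar R :=
  ereal_inf [set ((depth T)%:R)%:E | T in
    [set T : dtree X | based_on H T /\ (loss P T c <= eps%:E)%E]].

Definition approximable d (X : measurableType d) (R : realType)
    (c : set X) (H : set (set X)) : Prop :=
  forall (P : probability X R) (eps : R), 0 < eps ->
    exists2 T : dtree X, based_on H T & (loss P T c <= eps%:E)%E.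

(* Rates are functions on (0, 1]: their values outside this interval are
   irrelevant. *)
Definition interpretable d (X : measurableType d) (R : realType)
    (c : set X) (H : set (set X)) : Prop :=
  exists f : R -> nat, forall P : probability X R,
    exists2 epsP : R, 0 < epsP <= 1 &
      forall eps : R, 0 < eps <= epsP ->
        (depth_rate c H eps P <= ((f eps)%:R)%:E)%E.

Definition uniformly_interpretable_at d (X : measurableType d) (R : realType)
    (c : set X) (H : set (set X)) (f : R -> nat) : Prop :=
  forall (P : probability X R) (eps : R), 0 < eps <= 1 ->
    (depth_rate c H eps P <= ((f eps)%:R)%:E)%E.

Definition uniformly_interpretable_constant d (X : measurableType d)
    (R : realType) (c : set X) (H : set (set X)) : Prop :=
  exists k : nat, uniformly_interpretable_at c H (fun _ : R => k).

Definition uniformly_interpretable_log d (X : measurableType d)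
    (R : realType) (c : set X) (H : set (set X)) : Prop :=
  exists2 f : R -> nat, uniformly_interpretable_at c H f &
    (fun eps : R => (f eps)%:R : R^o) =O_ (0^'+)
      (fun eps : R => ln (eps^-1) : R^o).

Definition exactly_one (A B C : Prop) : Prop :=
  [\/ [/\ A, ~ B & ~ C], [/\ ~ A, B & ~ C] | [/\ ~ A, ~ B & C]].

(* Main.v *)
(* Interpretability yields weak learnability: otherwise a mixture of
   distributions that are hard for deeper and deeper trees defeats every rate.
   Boosting weak trees by multiplicative weights produces, for every
   distribution, a list of [8 * m] trees of bounded depth of which fewer than
   [m] err, outside a set of measure at most [2 ^- m]. The majority vote of the
   list is a tree of depth [O(m)], whence the logarithmic rate.

   When [H] has finite VC dimension, so has its dual class, and the points
   induce polynomially many patterns on any tuple of trees. For two points with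
   few errors and different labels, most trees of the list tell them apart; an
   epsilon-net argument (double sampling) extracts from the list a number of
   trees bounded independently of [m] that tells all such pairs apart, and the
   label is a function of the values of these trees.

   The examples live on the discrete space [nat], where empirical measures
   converge in total variation, hence uniformly over any class of sets. *)
From mathcomp Require Import all_boot.
From mathcomp Require Import zify.

Set Implicit Arguments.
Unset Strict Implicit.
Unset Printing Implicit Defensive.

(** * Shattering and double sampling *)

Definition fin_shatters (T : finType) (F : {set {set T}}) (S : {set T}) :=
  [forall B : {set T}, (B \subset S) ==> [exists A in F, A :&: S == B]].

Lemma fin_shattersP (T : finType) (F : {set {set T}}) (S : {set T}) :
  reflect (forall B : {set T}, B \subset S -> exists2 A, A \in F & A :&: S = B)
          (fin_shatters F S).
Proof.
apply: (iffP forallP) => [h B BS|h B].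
  by have /implyP/(_ BS)/exists_inP[A AF /eqP <-] := h B; exists A.
by apply/implyP => /h[A AF <-]; apply/exists_inP; exists A.
Qed.

(* Pajor's form of the Sauer-Shelah lemma: a set shattered both by the members
   of [F] containing [x] and by those avoiding [x] stays shattered by [F] after
   [x] is added to it. *)
Lemma card_le_shattered (T : finType) (F : {set {set T}}) :
  #|F| <= #|[set S | fin_shatters F S]|.
Proof.
have [n] := ubnP #|F|; elim: n F => // n IH F; rewrite ltnS => Fn.
have [F1|F1] := leqP #|F| 1.
  have [->|[A AF]] := set_0Vmem F; first by rewrite cards0.
  apply: leq_trans F1 _; rewrite card_gt0; apply/set0Pn; exists set0.
  rewrite inE; apply/fin_shattersP => B; rewrite subset0 => /eqP ->.
  by exists A; rewrite ?setI0.
have [A [B [AF BF AB]]] := card_gt1P F1.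
have [x] : exists x, (x \in A) != (x \in B).
  apply/existsP; apply: contraT; rewrite negb_exists => /forallP h.
  by case/negP: AB; apply/eqP/setP => x; apply/eqP; rewrite -[_ == _]negbK.
wlog xA : A B AF BF {AB} / x \in A => [hw xAB|].
  case: (boolP (x \in A)) => xA; first exact: (hw A B).
  apply: (hw B A) => //; last by rewrite eq_sym.
  by move: xAB; rewrite (negbTE xA); case: (x \in B).
rewrite xA; case xB: (x \in B) => // _.
pose F1' := [set C in F | x \in C]; pose F0 := [set C in F | x \notin C].
have FE : F = F1' :|: F0.
  by apply/setP => C; rewrite !inE -andb_orr orbN andbT.
have dis : [disjoint F1' & F0].
  rewrite -setI_eq0; apply/eqP/setP => C; rewrite !inE.
  by case: (C \in F); case: (x \in C).
have cF : #|F| = #|F1'| + #|F0|.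
  by rewrite FE cardsU disjoint_setI0// cards0 subn0.
have p1 : 0 < #|F1'| by rewrite card_gt0; apply/set0Pn; exists A;
  rewrite inE AF.
have p0 : 0 < #|F0|.
  by rewrite card_gt0; apply/set0Pn; exists B; rewrite inE BF xB.
(* Both halves are nonempty, so each is smaller than [F]. *)
have {}IH (G : {set {set T}}) :
    G \in [:: F1'; F0] -> #|G| <= #|[set S | fin_shatters G S]|.
  move=> GF; apply: IH; apply: leq_trans Fn; rewrite cF; move: GF.
  rewrite !inE => /orP[] /eqP ->; first by rewrite -addn1 leq_add2l.
  by rewrite -add1n leq_add2r.
set S1 := [set S | fin_shatters F1' S]; set S0 := [set S | fin_shatters F0 S].
(* The members of a half agree on [x], so no set shattered by a half contains [x]. Adding [x] to the
   sets of [S1 :&: S0] therefore yields new ones, and the total is [#|S1| + #|S0|]. *)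
have xS1 S : S \in S1 -> x \notin S.
  rewrite inE => /fin_shattersP h; apply/negP => xS.
  have [|C] := h set0; first exact: sub0set.
  by rewrite inE => /andP[_ xC] /setP/(_ x); rewrite !inE xC xS.
have xS0 S : S \in S0 -> x \notin S.
  rewrite inE => /fin_shattersP h; apply/negP => xS.
  have [|C] := h [set x]; first by rewrite sub1set.
  by rewrite inE => /andP[_ /negbTE xC] /setP/(_ x); rewrite !inE xC eqxx.
have : (S1 :|: S0) :|: [set x |: S | S in S1 :&: S0] \subset
    [set S | fin_shatters F S].
  apply/subsetP => S; rewrite [S \in _ :|: [set _ | _ in _]]in_setU => /orP[].
    have sub (G : {set {set T}}) : G \subset F -> fin_shatters G S ->
      fin_shatters F S.
      move=> GF /fin_shattersP h; apply/fin_shattersP => C /h[D DG <-].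
      by exists D => //; exact: (subsetP GF).
    rewrite !inE => /orP[]; apply: sub; rewrite FE;
      [exact: subsetUl|exact: subsetUr].
  case/imsetP => S' + ->; rewrite in_setI => /andP[S1S S0S].
  rewrite inE; apply/fin_shattersP => C CS.
  have CxS : C :\ x \subset S' by rewrite subDset.
  move: S1S S0S; rewrite !inE => /fin_shattersP/(_ _ CxS)[D1 + D1S].
  rewrite inE => /andP[D1F xD1] /fin_shattersP/(_ _ CxS)[D0 + D0S].
  rewrite inE => /andP[D0F xD0].
  have [xC|xC] := boolP (x \in C).
    exists D1 => //; rewrite setIUr D1S (setIidPr _) ?sub1set//.
    by rewrite setD1K.
  exists D0 => //; rewrite setIUr D0S (_ : D0 :&: [set x] = set0).
    by rewrite set0U; apply/setDidPl; rewrite disjoint_sym disjoints1.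
  by apply/setP => y; rewrite !inE; case: eqP => [->|];
    rewrite ?(negbTE xD0) ?andbF.
move/subset_leq_card; apply: leq_trans.
rewrite cardsU (_ : (S1 :|: S0) :&: _ = set0) ?cards0 ?subn0; last first.
  apply/setP => S; rewrite in_set0; apply/negbTE/negP;
    rewrite in_setI => /andP[Sx].
  case/imsetP => S' _ SE.
  suff : x \notin S by rewrite SE setU11.
  by move: Sx; rewrite in_setU => /orP[/xS1|/xS0].
rewrite card_in_imset; last first.
  move=> S S'; rewrite !in_setI => /andP[/xS1 xS _] /andP[/xS1 xS' _] SS'.
  by rewrite -(setU1K xS) SS' setU1K.
rewrite cardsU subnK ?cF;
  last exact: leq_trans (subset_leq_card (subsetIl _ _)) (leq_addr _ _).
by apply: leq_add; apply: IH; rewrite !inE eqxx ?orbT.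
Qed.

(** Such a set is recovered from the list of its elements, padded with [None] to length [n]. *)
Lemma card_sets_lt (T : finType) (n : nat) :
  #|[set S : {set T} | #|S| < n]| <= #|T|.+1 ^ n.
Proof.
rewrite -card_option -[X in _ ^ X]card_ord -card_ffun.
pose img (f : {ffun 'I_n -> option T}) := [set x | [exists i, f i == Some x]].
apply: leq_trans (leq_imset_card img predT).
apply/subset_leq_card/subsetP => S; rewrite inE => Sn.
apply/imsetP; exists [ffun i : 'I_n => onth (enum S) i] => //.
apply/setP => x; rewrite inE -mem_enum; apply/idP/existsP => [xS|[i]].
  have iS : index x (enum S) < n.
    by apply: leq_trans Sn; rewrite cardE ltnS ltnW// index_mem.
  by exists (Ordinal iS);
    rewrite ffunE /= (onthE) (nth_map x) ?index_mem// nth_index.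
rewrite ffunE onthE => /eqP iS.
have [ilt|ige] := ltnP i (size (enum S)).
  by move: iS; rewrite (nth_map x)// => -[<-]; exact: mem_nth.
by move: iS; rewrite nth_default// size_map.
Qed.

Lemma card_coordinate (J I : finType) (B : {set I}) (j : J) :
  #|[set s : {ffun J -> I} | s j \in B]| = #|B| * #|I| ^ #|J|.-1.
Proof.
pose F i (x : I) := if i == j then (x \in B : nat) else 1.
have := @bigA_distr_bigA _ 0 1 muln addn _ _ F.
rewrite (bigD1 j)//= {1}/F eqxx [X in _ * X = _](eq_bigr (fun=> #|I|));
  last first.
  by move=> i /negbTE ij; rewrite -sum1_card; apply: eq_bigr => x _;
    rewrite /F ij.
rewrite prod_nat_const cardC1 -big_mkcond/= sum1_card => ->.
rewrite -sum1dep_card big_mkcond; apply: eq_bigr => s _.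
rewrite (bigD1 j)//= big1 => [|i /negbTE ij]; last by rewrite /F ij.
by rewrite muln1 /F eqxx; case: (s j \in B).
Qed.

(** Markov's inequality: on average at most a quarter of the [r.*2] coordinates fall outside [D], so
    more than [r] of them do for at most half of the functions. *)
Lemma card_often_in (I : finType) (D : {set I}) (r : nat) : 0 < r ->
  4 * #|~: D| <= #|I| ->
  #|I| ^ r.*2 <=
    2 * #|[set s : {ffun 'I_r.*2 -> I} | r <= #|[set j | s j \in D]|]|.
Proof.
move=> r0 DI; set G := [set s | _].
have cG : #|G| + #|~: G| = #|I| ^ r.*2 by rewrite cardsC card_ffun card_ord.
suff : 2 * #|~: G| <= #|I| ^ r.*2.
  by move: cG; lia.
suff : r * #|~: G| <= r.*2 * (#|~: D| * #|I| ^ (r.*2).-1).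
  move=> h; rewrite -(leq_pmul2l r0).
  have -> : #|I| ^ r.*2 = #|I| * #|I| ^ (r.*2).-1.
    by rewrite -expnS prednK// double_gt0.
  set p := #|I| ^ _ in h *.
  have : 4 * #|~: D| * p <= #|I| * p by rewrite leq_mul2r DI orbT.
  move: h; move: #|~: G| => a; move: #|~: D| #|I| => b c; rewrite -mul2n; nia.
have -> : r.*2 * (#|~: D| * #|I| ^ (r.*2).-1) =
    \sum_(j < r.*2) #|[set s : {ffun 'I_r.*2 -> I} | s j \in ~: D]|.
  rewrite (eq_bigr (fun=> #|~: D| * #|I| ^ (r.*2).-1)).
    by rewrite sum_nat_const card_ord.
  by move=> j _; rewrite card_coordinate card_ord.
under eq_bigr do rewrite -sum1dep_card big_mkcond.
rewrite exchange_big/= mulnC -sum_nat_const big_mkcond; apply: leq_sum => s _.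
case: ifPn => //; rewrite !inE -ltnNge => sD.
rewrite -big_mkcond sum1dep_card.
have := cardsC [set j | s j \in D]; rewrite card_ord.
rewrite (_ : ~: [set j | s j \in D] = [set j | s j \in ~: D]); last first.
  by apply/setP => j; rewrite !inE.
move: #|[set j | s j \in D]| #|[set j | s j \in ~: D]| sD => a b; lia.
Qed.

(** Where [A] meets the pair over [j], at most one value of [b j] avoids it; elsewhere both are
    free. *)
Lemma card_avoiding_selections (J : finType) (A : {set J * bool}) :
  #|[set b : {ffun J -> bool} | [forall j, (j, b j) \notin A]]| <=
    2 ^ (#|J| - #|[set j | [exists b, (j, b) \in A]]|).
Proof.
set U := [set j | _].
have -> : [set b : {ffun J -> bool} | [forall j, (j, b j) \notin A]] =
    [set b in family (fun j => [pred b | (j, b) \notin A])].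
  by apply/setP => b; rewrite !inE.
rewrite cardsE card_family foldrE big_map big_enum/=.
have -> : #|J| - #|U| = #|~: U| by rewrite [RHS]cardsCs setCK.
rewrite -prod_nat_const [X in _ <= X]big_mkcond; apply: leq_prod => j _.
rewrite /U !inE; have [/existsP[b jb]|_]/= := boolP [exists b, (j, b) \in A];
  last by rewrite -card_bool max_card.
apply: leq_trans (subset_leq_card _) (eq_leq (card1 (~~ b))).
apply/subsetP => b'; rewrite !inE; apply: contraNT.
by case: b jb; case: b'.
Qed.

(* Double sampling: if no [s] works then half of the pairs [(s, s')] have an
   [s] missing some [D] that [s'] hits at least [r] times. Swapping coordinates
   of [s] and [s'] preserves the uniform measure on pairs, whereas for a fixed
   trace at most [2 ^ r] of the [2 ^ r.*2] swaps leave the pair in such a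
   position. *)
Lemma hitting_sample (I : finType) (F : {set {set I}}) (r q : nat) :
  0 < #|I| -> 0 < r -> 2 * q < 2 ^ r ->
  (forall D, D \in F -> 4 * #|~: D| <= #|I|) ->
  (forall p : 'I_r.*2 * bool -> I,
    #|[set p @^-1: D | D : {set I} in F]| <= q) ->
  exists s : {ffun 'I_r.*2 -> I}, forall D, D \in F -> exists j, s j \in D.
Proof.
move=> I0 r0 qr Fbig Ftr.
pose S := {ffun 'I_r.*2 -> I}.
pose hits (s : S) := [forall D in F, [exists j, s j \in D]].
suff /existsP[s /forall_inP sF] : [exists s, hits s].
  by exists s => D DF; apply/existsP; exact: sF.
apply: contraT; rewrite negb_exists => /forallP nohit.
pose bad (z : S * S) := [exists D in F,
  [forall j, z.1 j \notin D] && (r <= #|[set j | z.2 j \in D]|)].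
pose swap (b : {ffun 'I_r.*2 -> bool}) (z : S * S) : S * S :=
  ([ffun j => if b j then z.2 j else z.1 j],
   [ffun j => if b j then z.1 j else z.2 j]).
have swapK b : involutive (swap b).
  move=> [s s']; rewrite /swap/=; congr pair; apply/ffunP => j;
    rewrite !ffunE/=;
  by case: (b j).
have many : #|I| ^ r.*2 * #|I| ^ r.*2 <= 2 * \sum_z bad z.
  rewrite -(pair_bigA _ (fun s s' => bad (s, s') : nat))/=.
  have {1}<- : #|{: S}| = #|I| ^ r.*2 by rewrite card_ffun card_ord.
  rewrite -sum_nat_const big_distrr/=; apply: leq_sum => s _.
  have := nohit s; rewrite negb_forall_in => /exists_inP[D DF].
  rewrite negb_exists => sD.
  apply: leq_trans (card_often_in r0 (Fbig _ DF)) _.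
  rewrite leq_mul2l/= -sum1dep_card big_mkcond; apply: leq_sum => s' _.
  case: ifP => // s'D; rewrite lt0b; apply/exists_inP; exists D => //.
  by rewrite sD.
have swapE : \sum_z \sum_b bad (swap b z) = 2 ^ r.*2 * \sum_z bad z.
  rewrite exchange_big/= (eq_bigr (fun=> \sum_z bad z)).
    by rewrite sum_nat_const card_ffun card_bool card_ord.
  by move=> b _; rewrite [RHS](reindex_inj (can_inj (swapK b))).
(* All swaps of [z] draw on the same [4 * r] entries, so [D] matters only through its preimage under
   [p], one of at most [q] sets. If it meets at least [r] coordinates, at most [2 ^ r] swaps select
   entries that avoid it. *)
have few z : \sum_b bad (swap b z) <= q * 2 ^ r.
  pose p (jb : 'I_r.*2 * bool) := if jb.2 then z.2 jb.1 else z.1 jb.1.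
  pose U (A : {set 'I_r.*2 * bool}) := [set j | [exists b, (j, b) \in A]].
  pose g (b : {ffun 'I_r.*2 -> bool}) (A : {set 'I_r.*2 * bool}) :=
    (r <= #|U A|) && [forall j, (j, b j) \notin A].
  have : \sum_b bad (swap b z) <=
      \sum_(b : {ffun 'I_r.*2 -> bool})
        \sum_(A in [set p @^-1: D | D : {set I} in F]) g b A.
    apply: leq_sum => b _; case: (boolP (bad _)) => //.
    case/exists_inP => D DF /andP[/forallP/= D1 D2].
    rewrite (bigD1 (p @^-1: D)) ?imset_f//=.
    suff -> : g b (p @^-1: D) by rewrite leq_addr.
    apply/andP; split.
      apply: leq_trans D2 (subset_leq_card _); apply/subsetP => j.
      (* The second sample holds at [j] the entry that [b] does not select. *)
      rewrite !inE ffunE => jD; apply/existsP; exists (~~ b j).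
      by rewrite inE /p/=; case: (b j) jD.
    by apply/forallP => j; have := D1 j; rewrite ffunE inE.
  move/leq_trans; apply; rewrite exchange_big/=.
  apply: leq_trans (leq_mul (Ftr p) (leqnn _)); rewrite -sum_nat_const.
  apply: leq_sum => A _; rewrite /g.
  have [rU|_] := leqP r #|U A|; last by rewrite big1.
  rewrite (eq_bigr (fun b => if b \in
    [set b : {ffun 'I_r.*2 -> bool} | [forall j, (j, b j) \notin A]]
    then 1 else 0)).
    rewrite -big_mkcond sum1_card;
      apply: leq_trans (card_avoiding_selections A) _.
    rewrite leq_exp2l// card_ord; move: rU; rewrite /U.
    by move: #|[set j | _]| => u; lia.
  by move=> b _; rewrite inE; case: [forall _, _].
have : \sum_z \sum_b bad (swap b z) <= #|I| ^ r.*2 * #|I| ^ r.*2 * (q * 2 ^ r).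
  have <- : #|{: S * S}| = #|I| ^ r.*2 * #|I| ^ r.*2.
    by rewrite card_prod !card_ffun card_ord.
  by rewrite -sum_nat_const; apply: leq_sum.
have N0 : 0 < #|I| ^ r.*2 * #|I| ^ r.*2 by rewrite muln_gt0 expn_gt0 I0.
(* With [e = 2 ^ r], double counting gives [e * (e * N) <= e * (2 * q * N)], against [2 * q < e]. *)
rewrite swapE; move: many; set s := \sum_z _; set N := _ * _ in N0 *.
have -> : 2 ^ r.*2 = 2 ^ r * 2 ^ r by rewrite -expnD addnn.
move: qr; set e := 2 ^ r => qe Ns es.
have : e * (e * N) <= e * (2 * q * N).
  apply: leq_trans (_ : e * (e * (2 * s)) <= _);
    first by rewrite !leq_mul2l Ns !orbT.
  have := leq_mul (leqnn 2) es; lia.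
rewrite leq_pmul2l ?leq_pmul2r// ?expn_gt0// leqNgt.
by rewrite qe.
Qed.

Lemma polynomial_lt_exponential (a e : nat) :
  exists2 r, 0 < r & 2 * (a * r).+1 ^ e < 2 ^ r.
Proof.
(* For this [r] the left side is at most 2 to the power [1 + (2 * w + a) * e], which is linear in
   [w], while [r] is at least the square of [w.+1]. *)
pose w := (2 * e + a * e).+1; exists (2 ^ (2 * w)); first by rewrite expn_gt0.
have h1 : (a * 2 ^ (2 * w)).+1 <= 2 ^ (2 * w + a).
  rewrite expnD mulnC; have := ltn_expl a (isT : 1 < 2).
  have : 0 < 2 ^ (2 * w) by rewrite expn_gt0.
  by move: (2 ^ (2 * w)) (2 ^ a) => x y; nia.
have h2 : 2 * (a * 2 ^ (2 * w)).+1 ^ e <= 2 ^ (1 + (2 * w + a) * e).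
  rewrite expnD expn1 leq_pmul2l// (expnM 2 (2 * w + a)).
  by move: h1; move: (2 ^ (2 * w + a)) => x; case: (e) => // e';
    rewrite leq_exp2r.
apply: leq_ltn_trans h2 _; rewrite ltn_exp2l//.
rewrite mul2n -addnn expnD.
have := ltn_expl w (isT : 1 < 2); move: (2 ^ w) => x wx.
have : w.+1 * w.+1 <= x * x by apply: leq_mul.
rewrite /w; nia.
Qed.

Require Import Defs.
From mathcomp Require Import all_boot all_order all_algebra.
From mathcomp Require Import all_classical all_reals all_analysis.
From mathcomp Require Import ring lra.
Import Order.TTheory GRing.Theory Num.Theory.
Import numFieldNormedType.Exports.
Local Open Scope classical_set_scope.
Local Open Scope ring_scope.

(** * Decision trees *)

Section grafting.
Context (X : Type).

Fixpoint graft (T : dtree X) (g : bool -> dtree X) : dtree X :=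
  match T with
  | Leaf b => g b
  | Node A T1 T0 => Node A (graft T1 g) (graft T0 g)
  end.

(** Running the trees in turn, with [cons b] recording each answer, turns any Boolean function of
    their answers into a tree; depths add up at worst. *)
Fixpoint combine (Ts : seq (dtree X)) (g : seq bool -> bool) : dtree X :=
  if Ts is T :: Ts' then graft T (fun b => combine Ts' (g \o cons b))
  else Leaf (g [::]).

Lemma tree_eval_graft T g x :
  tree_eval (graft T g) x = tree_eval (g (tree_eval T x)) x.
Proof. by elim: T => //= A T1 -> T0 ->; case: ifP. Qed.

Lemma tree_eval_combine Ts g x :
  tree_eval (combine Ts g) x = g [seq tree_eval T x | T <- Ts].
Proof. by elim: Ts g => //= T Ts IH g; rewrite tree_eval_graft IH. Qed.

Lemma depth_graft T g k :
  (forall b, depth (g b) <= k)%N -> (depth (graft T g) <= depth T + k)%N.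
Proof.
move=> gk; elim: T => [b|A T1 IH1 T0 IH0] /=; first exact: gk.
by rewrite addSn ltnS addn_maxl geq_max !leq_max IH1 IH0 orbT.
Qed.

Lemma based_on_graft (H : set (set X)) T g :
  based_on H T -> (forall b, based_on H (g b)) -> based_on H (graft T g).
Proof.
by move=> + gH; elim: T => //= A T1 IH1 T0 IH0 [HA /IH1 ? /IH0 ?]; split.
Qed.

Definition good_tree (H : set (set X)) (k : nat) (T : dtree X) :=
  based_on H T /\ (depth T <= k)%N.

Lemma good_tree_combine (H : set (set X)) k Ts g :
  (forall i, (i < size Ts)%N -> good_tree H k (nth (Leaf false) Ts i)) ->
  good_tree H (size Ts * k) (combine Ts g).
Proof.
elim: Ts g => [|T Ts IH] g TsH /=; first by split.
have [TH Tk] : good_tree H k T by exact: (TsH 0%N).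
have {}IH g' : good_tree H (size Ts * k) (combine Ts g').
  by apply: IH => i; exact: (TsH i.+1).
split; first by apply: based_on_graft => // b; exact: (IH _).1.
rewrite mulSn; apply: leq_trans (_ : (depth T + size Ts * k <= _)%N).
  by apply: depth_graft => b; exact: (IH _).2.
by rewrite leq_add2r.
Qed.

Fixpoint nodes (T : dtree X) : seq (set X) :=
  if T is Node A T1 T0 then A :: nodes T1 ++ nodes T0 else [::].

Lemma size_nodes T : (size (nodes T) < 2 ^ depth T)%N.
Proof.
elim: T => //= A T1 IH1 T0 IH0; rewrite size_cat expnS mul2n -addnn.
have h d e : (d <= e -> 2 ^ d <= 2 ^ e)%N by move=> de; rewrite leq_exp2l.
have := h _ _ (leq_maxl (depth T1) (depth T0)).
have := h _ _ (leq_maxr (depth T1) (depth T0)); lia.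
Qed.

Lemma based_on_nodes (H : set (set X)) T i :
  based_on H T -> (i < size (nodes T))%N -> H (nth set0 (nodes T) i).
Proof.
elim: T i => //= A T1 IH1 T0 IH0 [|i] [HA H1 H0] //=;
  rewrite ltnS size_cat nth_cat.
by case: (ltnP i (size (nodes T1))) => iT sT; [exact: IH1|apply: IH0 => //;
  lia].
Qed.

(** Points that agree on all queries follow the same path. This transfers bounds on patterns over
    sets of [H] to patterns over trees. *)
Lemma tree_eval_nodes T x y :
  (forall i, (i < size (nodes T))%N ->
    (x \in nth set0 (nodes T) i) = (y \in nth set0 (nodes T) i)) ->
  tree_eval T x = tree_eval T y.
Proof.
elim: T => //= A T1 IH1 T0 IH0 h; have /= <- := h 0%N isT.
have {}IH1 : tree_eval T1 x = tree_eval T1 y.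
  apply: IH1 => i i1; have := h i.+1; rewrite /= ltnS size_cat nth_cat i1.
  by apply; lia.
have {}IH0 : tree_eval T0 x = tree_eval T0 y.
  apply: IH0 => i i0; have := h (size (nodes T1) + i).+1.
  have -> /= : ((size (nodes T1) + i).+1 < size (nodes (Node A T1 T0)))%N.
    by rewrite /= ltnS size_cat ltn_add2l.
  by rewrite nth_cat ltnNge leq_addr/= addKn; exact.
by rewrite IH1 IH0.
Qed.

End grafting.

Lemma mem_tree_set (X : Type) (T : dtree X) x :
  (x \in tree_set T) = tree_eval T x.
Proof. by apply/idP/idP => [/set_mem|?]; [|apply/mem_set]. Qed.

(** * Patterns induced by points on finite families of sets *)

Definition frange (Y : Type) (A : finType) (f : Y -> A) : {set A} :=
  [set a | `[< exists y, f y = a >]]%SET.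

Lemma frangeP (Y : Type) (A : finType) (f : Y -> A) a :
  reflect (exists y, f y = a) (a \in frange f).
Proof. by rewrite inE; exact: asboolP. Qed.

(** [g] factors through [f], with an arbitrary value [b0] off the range of [f]. *)
Lemma card_frange_le (Y : Type) (A B : finType) (f : Y -> A) (g : Y -> B) :
  (forall x y, f x = f y -> g x = g y) -> (#|frange g| <= #|frange f|)%N.
Proof.
move=> fg; have [b0 _|/eq_card0 ->//] := pickP (mem (frange g)).
have [phi phiP] : {phi : A -> B & forall y, phi (f y) = g y}.
  have /choice[phi phiP] : forall a, exists b, forall y, f y = a -> g y = b.
    move=> a; have [[y <-]|no] := pselect (exists y, f y = a).
      by exists (g y) => z /fg.
    by exists b0 => y ya; case: no; exists y.
  by exists phi => y; rewrite -(phiP (f y) y).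
apply: leq_trans (leq_imset_card phi (frange f)).
apply/subset_leq_card/fintype.subsetP => b /frangeP[y <-].
by rewrite -phiP; apply: imset_f; apply/frangeP; exists y.
Qed.

(** The range of [trace A] is the dual class of the family [A]. *)
Definition trace (X : Type) (L : finType) (A : L -> set X) (x : X) : {set L} :=
  [set l | x \in A l]%SET.

Lemma mem_trace (X : Type) (L : finType) (A : L -> set X) x l :
  (l \in trace A x) = (x \in A l).
Proof. by rewrite finset.in_set. Qed.

(* Index [2 ^ n] of the shattered sets by the subsets of ['I_n]; the points
   [x j] lying in exactly those whose index contains [j] are shattered. *)
Lemma shatters_of_dual (X : Type) (H : set (set X)) (L : finType)
    (A : L -> set X) (n : nat) (K : {set L}) :
  (forall l, H (A l)) -> fin_shatters (frange (trace A)) K ->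
  (2 ^ n <= #|K|)%N -> exists S : set X, (S #= `I_n)%card /\ shatters H S.
Proof.
move=> HA /fin_shattersP Ksh nK.
have cK : (#|{: {set 'I_n}}| <= #|K|)%N by rewrite -cardsT -powersetT
  card_powerset cardsT card_ord.
pose phi (B : {set 'I_n}) : L := enum_val (widen_ord cK (enum_rank B)).
have phiK B : phi B \in K by exact: enum_valP.
have phi_inj : injective phi.
  by move=> B C /enum_val_inj/(congr1 val)/= /val_inj/enum_rank_inj.
have /choice[x xP] : forall j : 'I_n, exists x,
    forall B, (x \in A (phi B)) = (j \in B).
  move=> j; have [|W /frangeP[x <-] xK] :=
    Ksh [set phi B | B : {set 'I_n} in [set B : {set 'I_n} | j \in B]]%SET.
    by apply/fintype.subsetP => l /imsetP[B _ ->].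
  exists x => B; have := congr1 (fun U : {set L} => phi B \in U) xK.
  rewrite finset.in_setI phiK andbT /= inE => ->; by rewrite mem_imset// inE.
have x_inj : injective x.
  move=> i j xij; have := xP i [set i]%SET; rewrite xij xP !inE eqxx.
  by move/eqP.
exists (range x); split.
  rewrite card_eq_sym.
  have -> : `I_n = range (@nat_of_ord n).
    by apply/seteqP; split=> [k kn|_ [i _ <-]] /=;
      [exists (Ordinal kn)|exact: ltn_ord].
  apply: (@card_eq_trans _ _ _ _ [set: 'I_n]).
    by apply: inj_card_eq => i j _ _; exact: val_inj.
  by rewrite card_eq_sym; apply: inj_card_eq => i j _ _; exact: x_inj.
move=> B Bx; pose b := [set j : 'I_n | x j \in B]%SET.
exists (A (phi b)); first exact: HA.
apply/seteqP; split => [y [yA [j _ jy]]|y By].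
  by have := xP j b; rewrite jy (mem_set yA) inE jy => /esym/set_mem.
have [j _ jy] := Bx _ By; split; last by exists j.
by apply/set_mem; rewrite -jy xP inE jy; exact/mem_set.
Qed.

(** By [shatters_of_dual] the dual class shatters only index sets with fewer than [2 ^ n] elements,
    so the Sauer-Shelah bound applies to it. *)
Lemma card_traces (X : Type) (H : set (set X)) (n : nat) (L : finType)
    (A : L -> set X) :
  (forall S : set X, (S #= `I_n)%card -> ~ shatters H S) ->
  (forall l, H (A l)) -> (#|frange (trace A)| <= #|L|.+1 ^ (2 ^ n))%N.
Proof.
move=> nsh HA; apply: leq_trans (card_le_shattered _) _.
apply: leq_trans (card_sets_lt _ _); apply/subset_leq_card/fintype.subsetP => K.
rewrite !inE ltnNge => Ksh; apply/negP => /(shatters_of_dual HA Ksh)[S [Sn]].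
exact: nsh.
Qed.

(** Each tree makes fewer than [2 ^ k] queries, which determine its answers; the traces on the trees
    are thus no more numerous than those on all their nodes together. *)
Lemma card_tree_traces (X : Type) (H : set (set X)) (n k : nat) (J : finType)
    (T : J -> dtree X) :
  (forall S : set X, (S #= `I_n)%card -> ~ shatters H S) ->
  (forall j, good_tree H k (T j)) ->
  (#|frange (trace (fun j => tree_set (T j)))| <=
    (#|J| * 2 ^ k).+1 ^ (2 ^ n))%N.
Proof.
move=> nsh TH; pose L := {j : J & 'I_(size (nodes (T j)))}.
pose A (l : L) := nth set0 (nodes (T (tag l))) (tagged l).
have cL : (#|{: L}| <= #|J| * 2 ^ k)%N.
  rewrite card_tagged sumnE big_map big_enum/= -sum_nat_const;
    apply: leq_sum => j _.
  rewrite card_ord; apply: ltnW; apply: leq_trans (size_nodes (T j)) _.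
  by rewrite leq_exp2l// (TH j).2.
apply: leq_trans (_ : #|frange (trace A)| <= _)%N; last first.
  apply: leq_trans (card_traces nsh _) _; first by move=> [j i];
    exact: (based_on_nodes (TH j).1).
  by rewrite leq_exp2r ?expn_gt0.
apply: card_frange_le => x y xy; apply/setP => j;
  rewrite !mem_trace !mem_tree_set.
apply: tree_eval_nodes => i ilt.
have /setP/(_ (Tagged (fun j => 'I_(size (nodes (T j)))) (Ordinal ilt))) := xy.
by rewrite !mem_trace.
Qed.

Lemma VC_dim_pinfty (R : realType) (X : Type) (H : set (set X)) :
  (forall n : nat, exists S : set X, (S #= `I_n)%card /\ shatters H S) ->
  VC_dim R H = +oo%E.
Proof.
move=> Hsh; apply/eqyP => A A0; pose m := `|Num.ceil A|%N.
have [S SH] := Hsh m.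
apply: (@le_trans _ _ (m%:R)%:E); last first.
  by apply: ereal_sup_ubound; exists m => //; exists S.
rewrite lee_fin /m natr_absz ger0_norm ?Num.Theory.ceil_ge//.
by rewrite ceil_ge0; exact: lt_trans A0.
Qed.

Lemma finite_VC_dim (R : realType) (X : Type) (H : set (set X)) :
  (VC_dim R H < +oo)%E ->
  exists n : nat, forall S : set X, (S #= `I_n)%card -> ~ shatters H S.
Proof.
move=> VC; apply: contrapT => /forallNP noH.
suff VCoo : VC_dim R H = +oo%E by rewrite VCoo ltxx in VC.
apply: VC_dim_pinfty => n; apply: contrapT => noS; apply: (noH n) => S Sn SH.
by apply: noS; exists S.
Qed.

Lemma tree_of_often_correct_trees (X : Type) (H : set (set X)) (n k : nat) :
  (forall S : set X, (S #= `I_n)%card -> ~ shatters H S) ->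
  exists K : nat, forall (I : finType) (T : I -> dtree X) (c G : set X),
    (0 < #|I|)%N -> (forall i, good_tree H k (T i)) ->
    (forall x, G x ->
      (8 * #|[set i | tree_eval (T i) x != (x \in c)]%SET| <= #|I|)%N) ->
    exists2 T' : dtree X, good_tree H K T' &
      forall x, G x -> tree_eval T' x = (x \in c).
Proof.
move=> nsh.
(* Two samples of [r.*2] trees are [4 * r] trees with fewer than [2 ^ k] queries each. The exponent
   is doubled because the members of [F] come from pairs of points. *)
have [r r0 rQ] := polynomial_lt_exponential (4 * 2 ^ k) (2 ^ n * 2).
pose Q := ((4 * 2 ^ k * r).+1 ^ (2 ^ n))%N.
exists (r.*2 * k)%N => I T c G I0 TH TG.
pose D (xy : X * X) :=
  [set i | tree_eval (T i) xy.1 != tree_eval (T i) xy.2]%SET.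
pose F := [set B : {set I} | `[< exists xy : X * X,
  [/\ G xy.1, G xy.2, (xy.1 \in c) != (xy.2 \in c) & D xy = B] >]]%SET.
have Ftr (p : 'I_r.*2 * bool -> I) :
    (#|[set p @^-1: B | B : {set I} in F]%SET| <= Q * Q)%N.
  pose V := trace (fun j => tree_set (T (p j))).
  have VQ : (#|frange V| <= Q)%N.
    apply: leq_trans (card_tree_traces nsh (fun j => TH (p j))) _.
    rewrite card_prod card_ord card_bool /Q leq_exp2r ?expn_gt0// ltnS.
    by rewrite -muln2; lia.
  apply: leq_trans (leq_mul VQ VQ); rewrite -cardsX.
  pose VV (xy : X * X) := (V xy.1, V xy.2).
  apply: leq_trans (_ : #|frange VV| <= _)%N; last first.
    apply/subset_leq_card/fintype.subsetP => _ /frangeP[xy <-].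
    by rewrite finset.in_setX; apply/andP; split; apply/frangeP;
      [exists xy.1|exists xy.2].
  apply: leq_trans (_ : #|frange (fun xy => p @^-1: D xy)| <= _)%N.
    apply/subset_leq_card/fintype.subsetP => _ /imsetP[B + ->].
    rewrite inE => /asboolP[xy [_ _ _ <-]].
    by apply/frangeP; exists xy.
  apply: card_frange_le => -[x x'] [y y'] [/setP xy /setP xy'].
  apply/setP => j; rewrite !inE/=.
  by have := xy j; have := xy' j; rewrite !mem_trace !mem_tree_set => -> ->.
have Fbig B : B \in F -> (4 * #|~: B| <= #|I|)%N.
  rewrite inE => /asboolP[[x y] /= [Gx Gy xy <-]].
  pose E z := [set i | tree_eval (T i) z != (z \in c)]%SET.
  (* At each of the two points at most an eighth of the trees err, and a tree right at both tells
     them apart. *)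
  have DE : ~: D (x, y) \subset E x :|: E y.
    apply/fintype.subsetP => i; rewrite !inE/= negbK => /eqP Txy.
    by move: xy; rewrite Txy; case: (tree_eval _ _); case: (_ \in _);
      case: (_ \in _).
  have : (#|~: D (x, y)| <= #|E x| + #|E y|)%N.
    exact: leq_trans (subset_leq_card DE) (leq_card_setU _ _).
  have : (8 * #|E x| <= #|I|)%N := TG _ Gx.
  have : (8 * #|E y| <= #|I|)%N := TG _ Gy.
  by move: #|E x| #|E y| #|~: _| #|I| => ? ? ? ?; lia.
have rQ' : (2 * (Q * Q) < 2 ^ r)%N.
  by rewrite /Q mulnn -expnM.
have [s sF] := hitting_sample I0 r0 rQ' Fbig Ftr.
pose Ts := [seq T (s j) | j <- enum 'I_r.*2].
(* [g] accepts the answer vectors of the points of [G] in [c]. Since the sample meets every member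
   of [F], no point of [G] outside [c] shares such a vector. *)
pose g v := `[<
  exists x, [/\ G x, x \in c & [seq tree_eval t x | t <- Ts] = v] >].
exists (combine Ts g).
  have <- : size Ts = r.*2 by rewrite size_map size_enum_ord.
  apply: good_tree_combine => i; rewrite size_map => ilt.
  have j0 : 'I_r.*2 by case: (enum 'I_r.*2) ilt.
  by rewrite (nth_map j0)//; exact: TH.
move=> x Gx; rewrite tree_eval_combine.
apply/asboolP/idP => [[y [Gy yc yx]]|xc]; last by exists x.
apply: contraT => xc; have [|j] := sF (D (y, x)).
  by rewrite inE; apply/asboolP; exists (y, x); split => //=;
    rewrite yc (negbTE xc).
rewrite inE/= => /eqP []; move: yx; rewrite -!map_comp => /eq_in_map yx.
by apply: (yx j); rewrite -enumT mem_enum.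
Qed.

(** * Boosting *)

Section learning.
Context d (X : measurableType d) (R : realType) (c : set X) (H : set (set X)).
Hypotheses (mc : measurable c) (mH : forall A, H A -> measurable A).

Definition error_set (T : dtree X) := [set x | tree_eval T x != (x \in c)].

Lemma measurable_tree_set T : based_on H T -> measurable (tree_set T).
Proof.
elim: T => [b|A T1 IH1 T0 IH0] /=.
  case: b => _; last by rewrite (_ : tree_set _ = set0)//; apply/seteqP; split.
  by rewrite (_ : tree_set _ = setT)//; apply/seteqP; split.
case=> /mH mA /IH1 m1 /IH0 m0.
rewrite (_ : tree_set _ = (A `&` tree_set T1) `|` (tree_set T0 `\` A)).
  by apply: measurableU; [exact: measurableI|exact: measurableD].
rewrite /tree_set; apply/seteqP; split => x /=.
  by case: ifPn => [/set_mem|/negP] Ax ?; [left|right; split => // /mem_set].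
by move=> [[/mem_set -> //]|[? Ax]]; rewrite memNset.
Qed.

Lemma measurable_error_set T : based_on H T -> measurable (error_set T).
Proof.
move=> /measurable_tree_set mT.
rewrite (_ : error_set T = (tree_set T `\` c) `|` (c `\` tree_set T)).
  by apply: measurableU; exact: measurableD.
rewrite /error_set /tree_set; apply/seteqP; split => x /=.
  case: (boolP (x \in c)) => [/set_mem xc|xc]; case: tree_eval => // _.
    by right; split.
  by left; split => // cx; case/negP: xc; exact/mem_set.
move=> [[-> xc]|[/mem_set ->]]; first by rewrite memNset.
by case: tree_eval.
Qed.

Lemma depth_rateP (eps : R) (P : probability X R) (k : nat) :
  (depth_rate c H eps P <= k%:R%:E)%E <->
  exists2 T, good_tree H k T & (P (error_set T) <= eps%:E)%E.
Proof.
split=> [h|[T [TH Tk] Teps]].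
  (* Depths are integers, so a tree of depth below [k.+1] has depth at most [k]. *)
  have : (depth_rate c H eps P < k.+1%:R%:E)%E.
    by apply: le_lt_trans h _; rewrite lte_fin ltr_nat.
  move=> /ereal_inf_lt[_ [T [TH Teps] <-]]; rewrite lte_fin ltr_nat ltnS => Tk.
  by exists T.
apply: (@le_trans _ _ (depth T)%:R%:E); last by rewrite lee_fin ler_nat.
by apply: ereal_inf_lbound; exists T.
Qed.

Definition learnable (eps : R) (k : nat) := forall P : probability X R,
  exists2 T, good_tree H k T & (P (error_set T) <= eps%:E)%E.

(** [P] is the default of [mnormalize] for a total mass that is zero or infinite. *)
Lemma exists_normalization (mu : {measure set X -> \bar R})
    (P : probability X R) :
  (0 < mu setT)%E -> (mu setT < +oo)%E ->
  exists Q : probability X R, forall A, mu A = (mu setT * Q A)%E.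
Proof.
move=> mu0 muoo; exists (mnormalize mu P) => A.
have QA : mnormalize mu P A = (mu A * (fine (mu setT))^-1%:E)%E.
  by rewrite /mnormalize gt_eqF// lt_eqF.
rewrite -[X in _ = (_ * X)%E]/(mnormalize mu P A) QA muleCA.
have muf : mu setT \is a fin_num by rewrite ge0_fin_numE.
rewrite -[X in (_ * (X * _))%E](fineK muf) -EFinM mulfV ?mule1//.
by rewrite fine_eq0// gt_eqF.
Qed.

(* A mixture, with weights [2 ^- n.+1], of distributions [P n] that no tree of
   depth [f (eps / 2 ^+ n.+1)] fits up to [eps] is not fitted up to
   [eps / 2 ^+ n.+1] by such trees, for any [n]. *)
Lemma learnable_of_interpretable (eps : R) :
  0 < eps -> interpretable R c H -> exists k, learnable eps k.
Proof.
move=> eps0 [f fP]; apply: contrapT => /forallNP nolearn.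
have /choice[P noP] : forall n : nat, exists P : probability X R,
    forall T, good_tree H (f (eps / 2 ^+ n.+1)) T ->
      (eps%:E < P (error_set T))%E.
  move=> n; apply: contrapT => noP; apply: (nolearn (f (eps / 2 ^+ n.+1))) => P.
  apply: contrapT => noT; apply: noP; exists P => T TH.
  by rewrite ltNge; apply/negP => Teps; apply: noT; exists T.
have w0 n : 0 <= 1 / (2 ^ n.+1)%:R :> R by rewrite divr_ge0.
pose mu : {measure set X -> \bar R} :=
  mseries (fun n => mscale (NngNum (w0 n)) (P n)) 0.
have muE A : mu A = (\sum_(0 <= n <oo) (1 / (2 ^ n.+1)%:R)%:E * P n A)%E by [].
have mu_ge n A : ((1 / (2 ^ n.+1)%:R)%:E * P n A <= mu A)%E.
  rewrite muE; apply: le_trans (nneseries_lim_ge n.+1 _); last first.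
    by move=> i _ _; rewrite mule_ge0// lee_fin w0.
  rewrite big_nat_recr//= leeDr// sume_ge0// => i _.
  by rewrite mule_ge0// lee_fin w0.
have mu1 : (mu setT <= 1)%E.
  rewrite muE; apply: le_trans (epsilon_trick0 xpredT ler01).
  by apply: lee_nneseries => // n _;
    rewrite ?probability_setT ?mule1 ?lee_fin ?w0.
have mu0 : (0 < mu setT)%E.
  apply: lt_le_trans (mu_ge 0%N setT); rewrite probability_setT mule1 lte_fin.
  by rewrite divr_gt0// ltr0n.
have [Q muQ] := exists_normalization (P 0%N) mu0 (le_lt_trans mu1 (ltry _)).
(* The total mass of [mu] is at most 1, so normalizing can only increase it. *)
have Q_ge A : (mu A <= Q A)%E.
  by rewrite muQ -[leRHS]mul1e lee_wpmul2r.
have [epsQ /andP[epsQ0 _] fQ] := fP Q.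
have [n nQ] : exists n, eps / 2 ^+ n.+1 <= epsQ.
  pose n := `|Num.ceil (eps / epsQ)|%N; exists n.
  rewrite ler_pdivrMr ?exprn_gt0// -ler_pdivrMl// mulrC.
  apply: (@le_trans _ _ n%:R).
    rewrite /n natr_absz ger0_norm ?Num.Theory.ceil_ge//.
    by rewrite ceil_ge0 (lt_le_trans _ (divr_ge0 (ltW eps0) (ltW epsQ0)))//
      ltrN10.
  by rewrite -natrX ler_nat;
    apply: leq_trans (ltnW (ltn_expl n (isT : 1 < 2)%N)) _; rewrite leq_exp2l.
have [|T TH Teps] := (depth_rateP _ _ _).1 (fQ (eps / 2 ^+ n.+1) _).
  by rewrite nQ divr_gt0// exprn_gt0.
have := noP n T TH; rewrite ltNge => /negP; apply.
have := le_trans (le_trans (mu_ge n _) (Q_ge _)) Teps.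
have : P n (error_set T) \is a fin_num by rewrite fin_num_measure//;
  exact: measurable_error_set TH.1.
move=> /fineK <-; rewrite -EFinM !lee_fin natrX mul1r mulrC.
by rewrite ler_pM2r// invr_gt0 exprn_gt0.
Qed.

Definition errors (Ts : seq (dtree X)) (x : X) : nat :=
  count (fun T => tree_eval T x != (x \in c)) Ts.

(** At [j = 0] the truncated predecessor leaves both conditions vacuous, as they should be. *)
Lemma errors_consE T Ts j :
  [set x | (j <= errors (T :: Ts) x)%N] =
  (error_set T `&` [set x | (j.-1 <= errors Ts x)%N]) `|`
  ([set x | (j <= errors Ts x)%N] `\` error_set T).
Proof.
rewrite /errors /error_set; apply/seteqP; split => x /=.
  case: (tree_eval T x != _) => /= h; [left|right]; split => //.
  by rewrite -subn1 leq_subLR.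
by move=> [[-> h]|[h /negP/negbTE ->]] //=; rewrite -leq_subLR subn1.
Qed.

Lemma measurable_errors Ts j :
  (forall i, (i < size Ts)%N -> based_on H (nth (Leaf false) Ts i)) ->
  measurable [set x | (j <= errors Ts x)%N].
Proof.
elim: Ts j => [|T Ts IH] j TsH.
  case: j => [|j]; first by rewrite (_ : [set _ | _] = setT)//; apply/seteqP;
    split.
  by rewrite (_ : [set _ | _] = set0)//; apply/seteqP; split.
have mT : measurable (error_set T) by apply: measurable_error_set;
  exact: (TsH 0%N).
have {}IH j' : measurable [set x | (j' <= errors Ts x)%N].
  by apply: IH => i; exact: (TsH i.+1).
by rewrite errors_consE; apply: measurableU;
  [exact: measurableI|exact: measurableD].
Qed.

(* Multiplicative weights: every round multiplies by 4 the mass of the points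
   misclassified by a tree chosen for the current normalized measure. *)
Lemma boosting_measure (eps : R) k (P : probability X R) n :
  0 <= eps -> learnable eps k ->
  exists (Ts : seq (dtree X)) (mu : {measure set X -> \bar R}),
    [/\ size Ts = n,
        forall i, (i < size Ts)%N -> good_tree H k (nth (Leaf false) Ts i),
        (mu setT <= ((1 + 3 * eps) ^+ n)%:E)%E &
        forall A j, measurable A ->
          ((4 ^+ j)%:E * P (A `&` [set x | (j <= errors Ts x)%N]) <= mu A)%E].
Proof.
move=> eps0 learn; elim: n => [|n [Ts [mu [sTs TsH mu_le mu_ge]]]].
  exists [::], P; split => [//|//||A [|j] mA].
  - by rewrite expr0; exact: probability_le1.
  - rewrite mul1e (_ : [set _ | _] = setT) ?setIT//.
    by apply/seteqP; split.
  - rewrite (_ : [set _ | _] = set0) ?setI0 ?measure0 ?mule0//.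
    by apply/seteqP; split.
have mE j : measurable [set x | (j <= errors Ts x)%N].
  by apply: measurable_errors => i /TsH[].
have mu_geP A : measurable A -> (P A <= mu A)%E.
  move=> mA; have := mu_ge A 0%N mA; rewrite mul1e.
  by rewrite (_ : [set _ | _] = setT) ?setIT//; apply/seteqP; split.
have mu1 : (1 <= mu setT)%E by rewrite -(probability_setT P); exact: mu_geP.
have muoo : (mu setT < +oo)%E by exact: le_lt_trans mu_le (ltry _).
have [Q muQ] := exists_normalization P (lt_le_trans lte01 mu1) muoo.
have [T TH Teps] := learn Q.
have mT : measurable (error_set T) := measurable_error_set TH.1.
(* Adding three times the restriction multiplies the mass of the error set by 4. Since [T] errs on a
   fraction at most [eps] of [mu], the total grows at most by the factor [1 + 3 * eps]. *)
pose mu' : {measure set X -> \bar R} :=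
  measure_add mu (mscale (NngNum (ler0n R 3)) (mrestr mu mT)).
have mu'E A : mu' A = (mu A + 3%:E * mu (A `&` error_set T))%E.
  exact: measure_addE.
exists (T :: Ts), mu'; split=> [|[|i]//=||A j mA].
- by rewrite /= sTs.
- exact: TsH.
- rewrite mu'E setTI (muQ (error_set T)) exprS EFinM muleCA.
  have muf : mu setT \is a fin_num by rewrite ge0_fin_numE.
  rewrite -[X in (X + _)%E]mule1 -ge0_muleDr// ?mule_ge0//.
  rewrite muleC; apply: lee_pmul => //; rewrite ?adde_ge0 ?mule_ge0//.
  by rewrite (EFinD 1 (3 * eps)); apply: leeD2l; rewrite EFinM;
    apply: lee_wpmul2l.
(* Splitting [A] along the error set is why the invariant ranges over all [A]: inside, the factor 4
   pays for one more error; outside, nothing changes. *)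
have muA : mu A = (mu (A `&` error_set T) + mu (A `\` error_set T))%E.
  by rewrite addeC; exact: measureDI.
rewrite errors_consE setIUr setIA -setIDAC.
rewrite measureU; first last.
- by apply/seteqP; split=> x //= -[[[_ ?] _] [[_]]].
- by apply: measurableI => //; exact: measurableD.
- by apply: measurableI => //; exact: measurableI.
rewrite mu'E muA ge0_muleDr// addeAC; apply: leeD; last first.
  by apply: mu_ge; exact: measurableD.
have mAT : measurable (A `&` error_set T) by exact: measurableI.
have e4 : (1 + 3%:E = 4%:E :> \bar R)%E by rewrite -EFinD; congr EFin; ring.
rewrite -[X in (_ <= X + _)%E]mul1e -ge0_muleDl// e4.
case: j => [|j] /=.
  (* At [j = 0] there is no error to pay for, and [1 <= 4] is enough. *)
  apply: le_trans (mu_ge _ 0%N mAT) _;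
    rewrite -{1}[mu _]mul1e lee_wpmul2r// lee_fin; lra.
rewrite exprS EFinM -muleA.
by rewrite lee_pmul2l//; exact: mu_ge.
Qed.

(** With error [48^-1] each round multiplies the total mass by at most 17/16, hence eight rounds by
    less than 2. Points with [m] errors weigh at least [4 ^+ m], which leaves them measure at most
    [(2 / 4) ^+ m]. *)
Lemma boosting k (P : probability X R) m :
  learnable 48^-1 k ->
  exists Ts : seq (dtree X),
    [/\ size Ts = (8 * m)%N,
        forall i, (i < size Ts)%N -> good_tree H k (nth (Leaf false) Ts i) &
        (P [set x | (m <= errors Ts x)%N] <= (2^-1 ^+ m)%:E)%E].
Proof.
move=> learn; have [|Ts [mu [sTs TsH mu_le mu_ge]]] :=
  boosting_measure P (8 * m) _ learn.
  by rewrite invr_ge0.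
exists Ts; split => //.
have mE : measurable [set x | (m <= errors Ts x)%N].
  by apply: measurable_errors => i /TsH[].
have := le_trans (mu_ge setT m measurableT) mu_le; rewrite setTI.
rewrite -(fineK (fin_num_measure P _ mE)) -EFinM !lee_fin => h.
have : (1 + 3 * 48^-1) ^+ (8 * m) <= 2 ^+ m :> R.
  by rewrite exprM lerXn2r ?nnegrE ?exprn_ge0//; lra.
move/(le_trans h); rewrite mulrC -ler_pdivlMr ?exprn_gt0// => /le_trans; apply.
by rewrite -expr_div_n (_ : 2 / 4 = 2^-1)//; field.
Qed.

End learning.

(** * From boosted lists of trees to depth rates *)

Section rates.
Context d (X : measurableType d) (R : realType) (c : set X) (H : set (set X)).
Hypotheses (mc : measurable c) (mH : forall A, H A -> measurable A).

(** The successor keeps the number of rounds positive at [eps = 1], so that boosting yields a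
    nonempty list. *)
Definition rounds (eps : R) : nat := `|Num.ceil (ln eps^-1 / ln 2)|.+1.

Lemma rounds_pow (eps : R) : 0 < eps <= 1 -> 2^-1 ^+ rounds eps <= eps.
Proof.
case/andP=> eps0 eps1;
  rewrite exprVn -[leRHS]invrK lef_pV2 ?posrE ?exprn_gt0 ?invr_gt0//.
have ln2 : 0 < ln (2 : R) by rewrite ln_gt0// ltr1n.
have lneps : 0 <= ln eps^-1 by rewrite ln_ge0// invf_ge1.
rewrite -ler_ln ?posrE ?exprn_gt0 ?invr_gt0// lnXn//.
rewrite -[ln 2 *+ _]mulr_natr [leRHS]mulrC -ler_pdivrMr// /rounds -[leRHS]natr1.
rewrite natr_absz ger0_norm; last first.
  by rewrite ceil_ge0 (lt_le_trans _ (divr_ge0 lneps (ltW ln2)))// ltrN10.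
by apply: (le_trans (Num.Theory.ceil_ge _)); rewrite lerDl.
Qed.

(** In this range the binary logarithm of [eps^-1] is at least 1, so a factor 3 absorbs the rounding
    and the successor, which add less than 2. *)
Lemma rounds_le (eps : R) : 0 < eps <= 2^-1 ->
  (rounds eps)%:R <= 3 / ln 2 * ln eps^-1.
Proof.
case/andP=> eps0 eps1.
have ln2 : 0 < ln (2 : R) by rewrite ln_gt0// ltr1n.
have lneps : ln 2 <= ln eps^-1.
  by rewrite ler_ln ?posrE ?invr_gt0// -[leLHS]invrK lef_pV2 ?posrE.
rewrite /rounds -[leLHS]natr1 natr_absz ger0_norm; last first.
  rewrite ceil_ge0; apply: lt_le_trans (divr_ge0 _ (ltW ln2));
    rewrite ?ltrN10//.
  exact: le_trans (ltW ln2) lneps.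
have := Num.Theory.ceilB1_lt (ln eps^-1 / ln 2); rewrite intrB.
have : 1 <= ln eps^-1 / ln 2 by rewrite ler_pdivlMr// mul1r.
rewrite mulrAC -mulrA; lra.
Qed.

Lemma majority_vote (T : seq (dtree X)) m x :
  size T = (8 * m)%N -> (errors c T x < m)%N ->
  (8 * m < 2 * count id [seq tree_eval t x | t <- T])%N = (x \in c).
Proof.
move=> sT Tx; rewrite count_map; set a := preim _ _.
have := count_predC a T; rewrite sT.
case: (boolP (x \in c)) => xc.
  have -> : count (predC a) T = errors c T x.
    by apply: eq_count => t /=; rewrite xc; case: tree_eval.
  by move=> h; apply/idP; lia.
have -> : count a T = errors c T x.
  by apply: eq_count => t /=; rewrite (negbTE xc); case: tree_eval.
by move=> _; apply/negbTE; lia.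
Qed.

Lemma measure_error_set_le (P : probability X R) T Ts m r :
  based_on H T -> (forall i, (i < size Ts)%N ->
    based_on H (nth (Leaf false) Ts i)) ->
  (forall x, (errors c Ts x < m)%N -> tree_eval T x = (x \in c)) ->
  (P [set x | (m <= errors c Ts x)%N] <= r)%E -> (P (error_set c T) <= r)%E.
Proof.
move=> TH TsH Tm; apply: le_trans; apply: le_measure; rewrite ?inE.
- exact: (measurable_error_set mc mH TH).
- exact: (measurable_errors mc mH _ TsH).
- by move=> x /= /eqP Tx; rewrite leqNgt; apply/negP => /Tm.
Qed.

Lemma uniformly_interpretable_log_of_interpretable :
  interpretable R c H -> uniformly_interpretable_log R c H.
Proof.
have e0 : 0 < 48^-1 :> R by rewrite invr_gt0.
move=> /(learnable_of_interpretable mc mH e0)[k learn].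
exists (fun eps => 8 * rounds eps * k)%N.
  move=> P eps eps01; apply/depth_rateP.
  have [Ts [sTs TsH Tsm]] := boosting mc mH P (rounds eps) learn.
  pose T := combine Ts (fun v => 8 * rounds eps < 2 * count id v)%N.
  exists T; first by rewrite -sTs; exact: good_tree_combine.
  apply: (@measure_error_set_le P T Ts (rounds eps)).
  - exact: (good_tree_combine _ TsH).1.
  - by move=> i /TsH[].
  - by move=> x Tx; rewrite tree_eval_combine; exact: majority_vote.
  - by apply: le_trans Tsm _; rewrite lee_fin rounds_pow.
(* The summand 1 keeps the constant positive when [k = 0]. *)
apply/eqO_exP; exists ((8 * k)%:R * (3 / ln 2) + 1).
  by rewrite ltr_wpDl// !mulr_ge0// invr_ge0 ln_ge0// ler1n.
near=> eps.
have eps0 : 0 < eps by near: eps; exact: nbhs_right_gt.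
have eps1 : eps <= 2^-1 by near: eps; apply: nbhs_right_le; rewrite invr_gt0.
have lneps : 0 <= ln eps^-1.
  by rewrite ln_ge0// invf_ge1// (le_trans eps1)// invf_le1// ler1n.
rewrite ger0_norm// ger0_norm// mulrDl mul1r -[leLHS]addr0 lerD//.
rewrite -mulrA mulnAC natrM ler_wpM2l//.
by rewrite rounds_le// eps0 eps1.
Unshelve. all: by end_near. Qed.

Lemma uniformly_interpretable_constant_of_interpretable :
  (VC_dim R H < +oo)%E ->
  interpretable R c H -> uniformly_interpretable_constant R c H.
Proof.
have e0 : 0 < 48^-1 :> R by rewrite invr_gt0.
move=> /finite_VC_dim[n nsh] /(learnable_of_interpretable mc mH e0)[k learn].
have [K KP] := tree_of_often_correct_trees k nsh.
exists K => P eps eps01; apply/depth_rateP.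
have [Ts [sTs TsH Tsm]] := boosting mc mH P (rounds eps) learn.
pose h (i : 'I_(size Ts)) := nth (Leaf false) Ts i.
have Ts0 : (0 < #|'I_(size Ts)|)%N by rewrite card_ord sTs.
(* Fewer than [rounds eps] errors among [8 * rounds eps] trees is less than an eighth, whatever
   [eps]; the list grows as [eps] shrinks, but [K] is already fixed. *)
have [|x|T TK TP] := KP _ h c [set x | (errors c Ts x < rounds eps)%N] Ts0.
- by move=> i; apply: TsH; exact: ltn_ord.
- rewrite /= => Tx; rewrite card_ord.
  apply: leq_trans (_ : (8 * rounds eps <= _)%N); last by rewrite sTs.
  rewrite leq_pmul2l//.
  apply: leq_trans (ltnW Tx);
    rewrite /errors -sum1_count (big_nth (Leaf false)) big_mkord.
  by rewrite sum1dep_card; apply/subset_leq_card/fintype.subsetP => i;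
    rewrite !inE.
exists T => //; apply: (@measure_error_set_le P T Ts (rounds eps)) => //.
- exact: TK.1.
- by move=> i /TsH[].
- by apply: le_trans Tsm _; rewrite lee_fin rounds_pow.
Qed.

Lemma interpretable_of_uniformly (f : R -> nat) :
  uniformly_interpretable_at c H f -> interpretable R c H.
Proof. by move=> Hf; exists f => P; exists 1;
  [rewrite ltr01 lexx|exact: Hf]. Qed.

Lemma approximable_of_uniformly (f : R -> nat) :
  uniformly_interpretable_at c H f -> approximable R c H.
Proof.
move=> Hf P eps eps0.
(* [eps] may exceed 1, where the rate says nothing. *)
have [|T TH Teps] := (depth_rateP _ _ _ _ _).1 (Hf P (Order.min eps 1) _).
  by rewrite lt_min eps0 ltr01 ge_min lexx orbT.
exists T; first exact: TH.1.
by apply: le_trans Teps _; rewrite lee_fin ge_min lexx.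
Qed.

End rates.

(** [A], [I] and [U] stand for approximability, interpretability and the uniform rate; deciding [A]
    and then [I] settles all cases. *)
Lemma exactly_one_of_iff (A I U : Prop) :
  (I -> U) -> (U -> I) -> (U -> A) -> exactly_one (~ A) (A /\ ~ I) U.
Proof.
move=> IU UI UA; have [HA|nA] := pselect A; last first.
  by apply: Or31; split; [exact: nA|case|move=> /UA].
have [HI|nI] := pselect I; last first.
  by apply: Or32; split; [apply|split|move=> /UI].
by apply: Or33; split; [apply|case|exact: IU].
Qed.

(** * Uniform convergence on the natural numbers *)

(** Expectation of [g] under the binomial law, by conditioning on the first trial so as to match the
    recursion of [iid]. *)
Fixpoint binomial_mean (R : realType) (p : R) (n : nat) (g : nat -> R) : R :=
  if n is n'.+1 then
    p * binomial_mean p n' (g \o S) + (1 - p) * binomial_mean p n' g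
  else g 0%N.

Lemma eq_binomial_mean (R : realType) (p : R) n (g h : nat -> R) :
  g =1 h -> binomial_mean p n g = binomial_mean p n h.
Proof. by move=> /funext ->. Qed.

Lemma ler_binomial_mean (R : realType) (p : R) n (g h : nat -> R) :
  0 <= p <= 1 -> (forall j, g j <= h j) ->
  binomial_mean p n g <= binomial_mean p n h.
Proof.
move=> /andP[p0 p1]; elim: n g h => //= n IH g h gh.
by apply: lerD; apply: ler_wpM2l; rewrite ?subr_ge0//; apply: IH => // j;
  exact: gh.
Qed.

Lemma binomial_meanZ (R : realType) (p a : R) n (g : nat -> R) :
  binomial_mean p n (fun j => a * g j) = a * binomial_mean p n g.
Proof.
elim: n g => //= n IH g; rewrite (IH g) (IH (g \o S)); ring.
Qed.

(** Variance plus squared bias. The centre [a] is arbitrary because a success shifts it by 1 in the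
    induction. *)
Lemma binomial_mean_sqr (R : realType) (p a : R) n :
  binomial_mean p n (fun j => (j%:R - a) ^+ 2) =
  n%:R * (p * (1 - p)) + (n%:R * p - a) ^+ 2.
Proof.
elim: n a => [a|n IH a] /=; first by rewrite mulr0n !mul0r !add0r.
rewrite IH (@eq_binomial_mean _ _ _ _ (fun j => (j%:R - (a - 1)) ^+ 2)).
  by rewrite IH -natr1; ring.
by move=> j /=; rewrite -natr1; congr (_ ^+ 2); ring.
Qed.

Section weak_law.
Context d (X : measurableType d) (R : realType) (P : probability X R).
Variables (A : set X) (mA : measurable A).

Definition hits n (s : n.-tuple X) : nat := count (mem A) s.

Lemma cons_pair_hits n (Q : pred nat) :
  @cons_pair X n @^-1` [set s | Q (hits s)] =
  (A `*` [set s : n.-tuple X | Q (hits s).+1]) `|`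
  (~` A `*` [set s | Q (hits s)]).
Proof.
apply/seteqP; split => -[x s] /=; rewrite /hits /=.
  by case: (boolP (x \in A)) => [/set_mem|/negP] xA ?; [left|right];
    split => // /mem_set.
by move=> [[/mem_set -> //]|[xA]]; rewrite memNset.
Qed.

Lemma measurable_hits n (Q : pred nat) :
  measurable [set s : n.-tuple X | Q (hits s)].
Proof.
elim: n Q => [|n IH] Q.
  case: (boolP (Q 0%N)) => Q0.
    rewrite (_ : [set _ | _] = setT)//; apply/seteqP; split => // s _ /=.
    by rewrite /hits tuple0.
  rewrite (_ : [set _ | _] = set0)//; apply/seteqP; split => // s /=.
  by rewrite /hits tuple0 (negbTE Q0).
have -> : [set s : n.+1.-tuple X | Q (hits s)] =
    (@tnth _ X ^~ ord0 @^-1` A `&`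
      (fun s : n.+1.-tuple X => [tuple of behead s]) @^-1`
        [set s | Q (hits s).+1]) `|`
    (@tnth _ X ^~ ord0 @^-1` (~` A) `&`
      (fun s : n.+1.-tuple X => [tuple of behead s]) @^-1`
        [set s | Q (hits s)]).
  apply/seteqP; split => s; case/tupleP: s => x s /=; rewrite /hits /= /tnth/=.
    by case: (boolP (x \in A)) => [/set_mem|/negP] xA ?; [left|right];
      split => // /mem_set.
  by move=> [[/mem_set -> //]|[xA]]; rewrite memNset.
have mt (B : set X) : measurable B ->
    measurable ((fun s : n.+1.-tuple X => tnth s ord0) @^-1` B).
  by move=> mB; rewrite -[X in measurable X]setTI; exact: measurable_tnth.
have mb (B : set (n.-tuple X)) : measurable B ->
    measurable ((fun s : n.+1.-tuple X => [tuple of behead s]) @^-1` B).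
  by move=> mB; rewrite -[X in measurable X]setTI; exact: measurable_behead.
apply: measurableU; apply: measurableI.
- exact: mt.
- by apply: mb; exact: (IH (Q \o S)).
- by apply: mt; exact: measurableC.
- by apply: mb; exact: IH.
Qed.

(** A first point in [A] replaces [Q] by [Q \o S], which is the recursion of [binomial_mean]. *)
Lemma iid_hits n (Q : pred nat) :
  iid P n [set s | Q (hits s)] =
  (binomial_mean (fine (P A)) n (fun j => (Q j)%:R))%:E.
Proof.
elim: n Q => [|n IH] Q /=.
  rewrite diracE; case: (boolP (Q 0%N)) => Q0.
    by rewrite mem_set.
  by rewrite memNset//=; exact/negP.
rewrite /distribution /pushforward
  -[X in _ X = _]/(@cons_pair X n @^-1` [set s | Q (hits s)]).
rewrite cons_pair_hits measureU; first last.
- by apply/seteqP; split=> -[x s]//= [[? _] [? _]].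
- by apply: measurableX; [exact: measurableC|exact: measurable_hits].
- by apply: measurableX => //; exact: (measurable_hits (Q \o S)).
have mS : measurable [set s : n.-tuple X | Q (hits s).+1].
  exact: (measurable_hits (Q \o S)).
have mQ : measurable [set s : n.-tuple X | Q (hits s)].
  exact: measurable_hits.
have e1 := @product_measure1E _ _ _ _ R P (iid P n) _ _ mA mS.
have e2 := @product_measure1E _ _ _ _ R P (iid P n) _ _ (measurableC mA) mQ.
transitivity (P A * iid P n [set s | Q (hits s).+1] +
    P (~` A) * iid P n [set s | Q (hits s)])%E.
  by congr (_ + _)%E; [exact: e1|exact: e2].
rewrite (IH Q) (IH (Q \o S)) probability_setC//.
have PA : P A \is a fin_num by rewrite fin_num_measure.
have PAE : P A = (fine (P A))%:E by rewrite fineK.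
by rewrite PAE /= -EFinB -!EFinM -EFinD.
Qed.

Lemma empirical_hits n (s : n.-tuple X) : empirical R s A = (hits s)%:R / n%:R.
Proof.
rewrite /empirical /hits; congr (_ / _).
rewrite -sum1_count natr_sum [RHS]big_mkcond/= big_tuple.
by apply: eq_bigr => i _; rewrite indicE; case: ifP.
Qed.

Lemma deviationE n (e : R) :
  [set s : n.-tuple X | e < `|empirical R s A - fine (P A)|] =
  [set s | (fun j => e < `|j%:R / n%:R - fine (P A)|) (hits s)].
Proof. by apply/seteqP; split => s /=; rewrite empirical_hits. Qed.

Lemma measurable_deviation n (e : R) :
  measurable [set s : n.-tuple X | e < `|empirical R s A - fine (P A)|].
Proof.
rewrite deviationE.
exact: (measurable_hits (fun j => e < `|j%:R / n%:R - fine (P A)|)).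
Qed.

(** Chebyshev's inequality, with the variance [p * (1 - p)] of one trial bounded by 1. *)
Lemma empirical_deviation n (e : R) : (0 < n)%N -> 0 < e ->
  (iid P n [set s | (e < `|empirical R s A - fine (P A)|)%R] <=
    ((n%:R * e ^+ 2)^-1)%:E)%E.
Proof.
move=> n0 e0; set p := fine (P A).
have p01 : 0 <= p <= 1.
  by rewrite fine_ge0//= -lee_fin fineK ?fin_num_measure// probability_le1.
have n0' : 0 < n%:R :> R by rewrite ltr0n.
pose Q (j : nat) := e < `|j%:R / n%:R - p|.
rewrite deviationE (iid_hits _ Q) lee_fin -/p.
apply: (@le_trans _ _ (binomial_mean p n
    (fun j => ((n%:R * e) ^+ 2)^-1 * (j%:R - n%:R * p) ^+ 2))).
  apply: ler_binomial_mean => // j; case: (boolP (Q j)) => [|_]; last first.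
    by rewrite mulr_ge0 ?invr_ge0 ?sqr_ge0.
  rewrite /Q (_ : j%:R / n%:R - p = (j%:R - n%:R * p) / n%:R); last first.
    by rewrite mulrBl mulrAC divff ?mul1r// gt_eqF.
  rewrite normrM (gtr0_norm (x := n%:R^-1)) ?invr_gt0// ltr_pdivlMr// => Qj.
  rewrite mulrC ler_pdivlMr ?exprn_gt0 ?mulr_gt0// mul1r -
    (real_normK (num_real (j%:R - _))).
  by rewrite lerXn2r ?nnegrE ?mulr_ge0// ?ltW// mulrC.
rewrite binomial_meanZ binomial_mean_sqr subrr expr0n addr0.
case/andP: p01 => p0 p1.
have pp : p * (1 - p) <= 1.
  by rewrite -[leRHS]mulr1; apply: ler_pM => //; lra.
have e2 : 0 < e ^+ 2 by rewrite exprn_gt0.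
rewrite exprMn expr2 -mulrA invfM -mulrA [leLHS]mulrC -!mulrA.
rewrite mulrCA [leLHS](_ : _ = p * (1 - p) * (n%:R * e ^+ 2)^-1).
  by rewrite -[leRHS]mul1r ler_wpM2r// invr_ge0 mulr_ge0 ?ltW.
by field; rewrite !gt_eqF.
Qed.

End weak_law.

(** * Reduction of total variation to finitely many atoms *)

Lemma additive_decomposition (R : realType) (nu : set nat -> R) (N : nat)
    (A : set nat) :
  (forall B C, B `&` C = set0 -> nu (B `|` C) = nu B + nu C) ->
  nu A = \sum_(j < N) ((j : nat) \in A)%:R * nu [set (j : nat)] +
    nu (A `\` `I_N).
Proof.
move=> nuD; elim: N => [|N ->].
  by rewrite big_ord0 add0r II0 setD0.
rewrite big_ord_recr/= -addrA; congr (_ + _).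
case: (boolP (N \in A)) => [/set_mem NA|/negP NA].
  rewrite mul1r -nuD.
    congr nu; apply/seteqP; split => [j [jA jN]|j [->|[jA jN]]].
    - case: (eqVneq j N) => [->|jN']; [by left|right; split => //=].
      by rewrite ltnS leq_eqVlt (negbTE jN').
    - by split => //=; rewrite ltnn.
    - by split => //= jN'; apply: jN => /=; exact: ltnW.
  by apply/seteqP; split => // j [/= -> [_]]; rewrite /= ltnSn.
rewrite mul0r add0r; congr nu; apply/seteqP; split => j [jA jN].
  by split => //=; rewrite ltnS leq_eqVlt => /orP[/eqP jN'|//]; apply: NA;
    rewrite -jN'; exact/mem_set.
by split => // jN'; apply: jN => /=; exact: ltnW.
Qed.

(** Atoms below [N] are compared one by one. As both totals are 1, the tail of [nu] exceeds that of
    [nu'] by at most the same sum of differences, whence the factor 2. *)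
Lemma le_dist_additive (R : realType) (nu nu' : set nat -> R) (N : nat)
    (A : set nat) :
  (forall B C, B `&` C = set0 -> nu (B `|` C) = nu B + nu C) ->
  (forall B C, B `&` C = set0 -> nu' (B `|` C) = nu' B + nu' C) ->
  (forall B, 0 <= nu B) -> (forall B, 0 <= nu' B) ->
  nu setT = 1 -> nu' setT = 1 ->
  `|nu A - nu' A| <=
    2 * (\sum_(j < N) `|nu [set (j : nat)] - nu' [set (j : nat)]|) +
    nu' (~` `I_N).
Proof.
move=> nuD nu'D nu0 nu'0 nuT nu'T.
have mono (m : set nat -> R) : (forall B C, B `&` C = set0 ->
  m (B `|` C) = m B + m C) ->
    (forall B, 0 <= m B) -> m (A `\` `I_N) <= m (~` `I_N).
  move=> mD m0; rewrite [leRHS](_ : _ = m (A `\` `I_N) + m (~` A `\` `I_N)).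
    by rewrite lerDl.
  rewrite -mD; first by congr m; rewrite -setDUl setUv setTD.
  by apply/seteqP; split => // j [[? _] []].
have := additive_decomposition N A nuD; have := additive_decomposition N A nu'D.
have := additive_decomposition N setT nuD;
  have := additive_decomposition N setT nu'D.
rewrite nuT nu'T setTD => T' T A' A_.
have S1 : `|\sum_(j < N) ((j : nat) \in A)%:R * nu [set (j : nat)] -
     \sum_(j < N) ((j : nat) \in A)%:R * nu' [set (j : nat)]| <=
    \sum_(j < N) `|nu [set (j : nat)] - nu' [set (j : nat)]|.
  rewrite -sumrB; apply: le_trans (ler_norm_sum _ _ _) _; apply: ler_sum => j _.
  by rewrite -mulrBr normrM; case: (_ \in _);
    rewrite ?normr1 ?mul1r ?normr0 ?mul0r.
have S2 : `|\sum_(j < N) ((j : nat) \in [set: nat])%:R * nu [set (j : nat)] -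
     \sum_(j < N) ((j : nat) \in [set: nat])%:R * nu' [set (j : nat)]| <=
    \sum_(j < N) `|nu [set (j : nat)] - nu' [set (j : nat)]|.
  rewrite -sumrB; apply: le_trans (ler_norm_sum _ _ _) _; apply: ler_sum => j _.
  by rewrite in_setT !mul1r.
have := mono _ nuD nu0; have := mono _ nu'D nu'0.
have := nu0 (A `\` `I_N); have := nu'0 (A `\` `I_N).
move: S1 S2 T' T A' A_;
  rewrite !ler_norml => /andP[? ?] /andP[? ?] ? ? ? ? ? ? ? ?.
by apply/andP; split; lra.
Qed.

Lemma exists_small_tail (R : realType) (P : probability nat R) (eps : R) :
  0 < eps -> exists N : nat, fine (P (~` `I_N)) <= eps.
Proof.
move=> eps0.
have : P \o (fun N => ~` `I_N) @ \oo --> P (\bigcap_N ~` `I_N).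
  apply: nonincreasing_cvg_mu => //;
    first exact: le_lt_trans (probability_le1 _ _) (ltry _).
  move=> n m nm; apply/subsetPset => j /= jm jn; apply: jm; exact: leq_trans nm.
rewrite (_ : \bigcap_N _ = set0); last first.
  by apply/seteqP; split => // j /(_ j.+1 I) /=; rewrite ltnSn.
rewrite measure0 => /fine_cvg/cvgr_lt/(_ _ eps0)[N _ NP].
by exists N; apply/ltW/(NP N); exact: leqnn.
Qed.

Lemma uniform_convergence_nat (R : realType) (P : probability nat R)
    (F : set (set nat)) : uniform_convergence P F.
Proof.
move=> eps eps0.
(* The tail takes one half of [eps]; [delta] is such that twice the sum of [N] atom deviations fits
   in the other half, with [N.+1] to avoid dividing by 0. *)
have [N NP] := exists_small_tail P (divr_gt0 eps0 (ltr0n R 2)).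
pose delta := eps / (4 * N.+1%:R).
have delta0 : 0 < delta by rewrite divr_gt0// mulr_gt0// ltr0n.
pose dev n j := [set s : n.-tuple nat |
  delta < `|empirical R s [set j] - fine (P [set j])|].
(* The factor 2 is there because [harmonic n] is the inverse of [n.+1], not of [n]. *)
pose C := 2 * N%:R / delta ^+ 2.
have C0 : 0 <= C by rewrite divr_ge0 ?mulr_ge0 ?exprn_ge0// ltW.
apply: (@squeeze_cvge _ _ _ _ (cst 0%E) _ (fun n => (C * harmonic n)%:E)).
- near=> n.
  have n0 : (0 < n)%N by near: n; exists 1%N.
  rewrite mu_ext_ge0//=.
  (* Finitely many measurable events, which do not depend on [A], cover the deviation event, so
     subadditivity bounds its outer measure. *)
  have : [set s : n.-tuple nat | exists2 A, F A & eps < `|empirical R s A -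
    fine (P A)|]
      `<=` \big[setU/set0]_(j < N) dev n j.
    move=> s [A _ epsA]; apply: contrapT => sdev.
    move: epsA; rewrite ltNge => /negP; apply.
    have sj (j : 'I_N) : `|empirical R s [set (j :
      nat)] - fine (P [set (j : nat)])| <= delta.
      rewrite leNgt; apply/negP => sj; apply: sdev.
      by rewrite -bigcup_mkord; exists (j : nat) => //=; exact: ltn_ord.
    have n0' : n%:R != 0 :> R by rewrite pnatr_eq0 -lt0n.
    apply: (@le_trans _ _ (2 * (\sum_(j < N)
        `|empirical R s [set (j : nat)] - fine (P [set (j : nat)])|) +
        fine (P (~` `I_N)))).
      apply: (@le_dist_additive R (empirical R s) (fun B => fine (P B))).
      + move=> B B' BB'; rewrite /empirical -mulrDl -big_split/=; congr (_ / _).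
        apply: eq_bigr => i _; rewrite !indicE in_setU.
        have : ~ (B (tnth s i) /\ B' (tnth s i)).
          by move=> bb; have : (B `&` B') (tnth s i) by []; rewrite BB'.
        case: (boolP (_ \in B)) => [/set_mem b|_];
          case: (boolP (_ \in B')) => [/set_mem b'|_] h;
          rewrite ?addr0 ?add0r//.
        by case: h.
      + by move=> B B' BB'; rewrite /= measureU// fineD// fin_num_measure.
      + by move=> B; rewrite /empirical divr_ge0// sumr_ge0.
      + by move=> B; rewrite fine_ge0.
      + rewrite /empirical (eq_bigr (fun=> 1)) => [|i _];
          last by rewrite indicT.
        by rewrite sumr_const card_ord divff.
      + by rewrite /= probability_setT.
    apply: (@le_trans _ _ (2 * (\sum_(j < N) delta) + eps / 2)).
      by rewrite lerD// ler_wpM2l// ler_sum// => j _; exact: sj.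
    rewrite sumr_const card_ord -(mulr_natr delta).
    have -> : delta * N%:R = eps / 4 * (N%:R / N.+1%:R).
      by rewrite /delta invfM mulrA -mulrA [N.+1%:R^-1 * _]mulrC.
    have : N%:R / N.+1%:R <= 1 :> R by rewrite ler_pdivrMr ?ltr0n// mul1r
      ler_nat.
    move: (N%:R / N.+1%:R) => x x1; nra.
  move/(le_mu_ext (iid P n)) => /le_trans; apply.
  apply: le_trans (outer_measure_subadditive (mu_ext (iid P n)) (dev n) N) _.
  apply: (@le_trans _ _ (\sum_(j < N) ((n%:R * delta ^+ 2)^-1)%:E)).
    apply: lee_sum => j _; rewrite /= measurable_mu_extE.
      exact: empirical_deviation.
    exact: measurable_deviation.
  rewrite sumEFin sumr_const card_ord lee_fin -[leLHS]mulr_natl /C /harmonic/=.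
  have n0' : 0 < n%:R :> R by rewrite ltr0n.
  have d2 : 0 < delta ^+ 2 by rewrite exprn_gt0.
  have -> : N%:R * (n%:R * delta ^+ 2)^-1 = N%:R / delta ^+ 2 * n%:R^-1.
    by rewrite invfM mulrCA mulrC.
  have -> : 2 * N%:R / delta ^+ 2 * n.+1%:R^-1 = N%:R / delta ^+ 2 * (2 /
    n.+1%:R).
    by ring.
  rewrite ler_wpM2l//; first by rewrite divr_ge0// ltW.
  rewrite ler_pdivlMr ?ltr0n// mulrC ler_pdivrMr// -natrM ler_nat; lia.
- exact: cvg_cst.
- apply: cvg_EFin; first by near=> n.
  rewrite -(mulr0 C); apply: cvgM; [exact: cvg_cst|exact: cvg_harmonic].
Unshelve. all: by end_near. Qed.

(** * Examples *)

Lemma standing_assumptions_nat (R : realType) (c : set nat)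
    (H : set (set nat)) :
  standing_assumptions R c H.
Proof. by split=> // P F _ _; exact: uniform_convergence_nat. Qed.

(** A shattered set is contained in a member of [H], hence in a singleton. *)
Lemma VC_dim_subsingletons (R : realType) (X : Type) (H : set (set X)) :
  (forall A, H A -> exists a, A `<=` [set a]) -> (VC_dim R H < +oo)%E.
Proof.
move=> H1; apply: (@le_lt_trans _ _ 1%E); last exact: ltry.
apply: ge_ereal_sup => _ [n [S [Sn SH]] <-]; rewrite lee_fin (ler_nat R n 1).
have [A HA AS] := SH S (@subset_refl _ S).
have [a Aa] := H1 _ HA.
rewrite -card_le_II -(card_le_eql Sn) -(card_le_eqr (@card_set1 _ a)).
by apply: subset_card_le => x; rewrite -AS => -[/Aa].
Qed.

Lemma VC_dim_setT_nat (R : realType) : VC_dim R [set: set nat] = +oo%E.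
Proof.
apply: VC_dim_pinfty => n; exists `I_n; split; first exact: card_eqxx.
by move=> B Bn; exists B => //; exact/setIidl.
Qed.

Lemma uniformly_interpretable_set0 (R : realType) d (X : measurableType d)
    (H : set (set X)) :
  uniformly_interpretable_at set0 H (fun _ : R => 0%N).
Proof.
move=> P eps /andP[eps0 _]; apply/depth_rateP; exists (Leaf false) => //.
rewrite (_ : error_set _ _ = set0) ?measure0 ?lee_fin ?ltW//.
by apply/seteqP; split => // x; rewrite /error_set /= in_set0.
Qed.

(** Only leaves are based on the empty class, and a constant errs at 0 or at 1, so with probability
    at least one half under the uniform distribution on these two points. *)
Lemma not_approximable_nat (R : realType) : ~ approximable R [set 0%N] set0.
Proof.
pose mu : {measure set nat -> \bar R} := measure_add (\d_0%N) (\d_1%N).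
have muE A : mu A = ((0%N \in A)%:R%:E + (1%N \in A)%:R%:E)%E.
  exact: measure_addE.
have muT : mu setT = 2%:E by rewrite muE !in_setT -EFinD; congr EFin; ring.
have [||Q muQ] := @exists_normalization _ _ _ mu (\d_0%N).
- by rewrite muT lte_fin.
- by rewrite muT ltry.
move=> /(_ Q 4^-1); rewrite invr_gt0 => /(_ (ltr0n _ _))[T TH].
rewrite leNgt => /negP; apply.
have : (1 <= mu (error_set [set 0%N] T))%E.
  have [b bT] : exists b, forall x, tree_eval T x = b by case: T TH =>
    [b _|A T1 T0 []//]; exists b.
  rewrite muE; case: b bT => bT.
    have -> : 1%N \in error_set [set 0%N] T.
      by apply/mem_set; rewrite /error_set/= bT memNset.
    by rewrite leeDr.
  have -> : 0%N \in error_set [set 0%N] T.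
    by apply/mem_set; rewrite /error_set/= bT mem_set.
  by rewrite leeDl.
rewrite muQ muT /loss -/(error_set [set 0%N] T).
rewrite -[Q _]fineK ?fin_num_measure// -EFinM lee_fin lte_fin; lra.
Qed.

Fixpoint lookup_tree (X : Type) (s : seq X) (f : pred X) : dtree X :=
  if s is a :: s' then Node [set a] (Leaf (f a)) (lookup_tree s' f)
  else Leaf false.

Lemma tree_eval_lookup (X : eqType) (s : seq X) f x :
  x \in s -> tree_eval (lookup_tree s f) x = f x.
Proof.
elim: s => //= a s IH; rewrite inE;
  case: ifPn => [/set_mem -> //|xa /orP[/eqP xa'|]//].
by case/negP: xa; exact/mem_set.
Qed.

Definition singletons (X : Type) : set (set X) := range set1.

Lemma based_on_lookup (X : Type) (s : seq X) f :
  based_on (@singletons X) (lookup_tree s f).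
Proof. by elim: s => //= a s IH; split => //; exists a. Qed.

(** Every point but the queried one moves to the second subtree, so only the points queried along
    that branch can escape its final label. *)
Lemma tree_eval_singletons (X : eqType) (T : dtree X) :
  based_on (@singletons X) T ->
  exists (s : seq X) (b : bool), (size s <= depth T)%N /\
    forall x, x \notin s -> tree_eval T x = b.
Proof.
elim: T => [b _|A T1 _ T0 IH /= [[a _ <-] _ /IH[s [b [sT sb]]]]];
  first by exists [::], b.
exists (a :: s), b; split => [|x];
  first by rewrite /= ltnS (leq_trans sT)// leq_maxr.
rewrite inE negb_or => /andP[xa xs]; rewrite memNset; first exact: sb.
by move=> /= xa'; rewrite xa' eqxx in xa.
Qed.

Definition evens : set nat := [set n | ~~ odd n].

(** A table of the first [N] numbers errs only on a tail of small measure. *)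
Lemma approximable_evens (R : realType) :
  approximable R evens (@singletons nat).
Proof.
move=> P eps eps0; have [N NP] := exists_small_tail P eps0.
exists (lookup_tree (iota 0 N) (fun n => ~~ odd n));
  first exact: based_on_lookup.
apply: (@le_trans _ _ (P (~` `I_N)));
  last by rewrite -[P _]fineK ?fin_num_measure// lee_fin.
apply: le_measure; rewrite ?inE// => x /= /eqP xN /= xlt; apply: xN.
rewrite tree_eval_lookup ?mem_iota//.
by apply/idP/idP => [?|/set_mem//]; exact/mem_set.
Qed.

(** On the first [2 * M] numbers a constant is wrong [M] times, and a tree of depth [k] corrects at
    most [k] of these errors. With [M = (2 * k).+1] more than a quarter remain wrong, which
    contradicts learnability up to [4^-1]. *)
Lemma not_interpretable_evens (R : realType) :
  ~ interpretable R evens (@singletons nat).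
Proof.
have e4 : 0 < 4^-1 :> R by rewrite invr_gt0.
move=> /(@learnable_of_interpretable _ nat R evens (@singletons nat) I (fun _ _
  => I) _ e4)[k].
pose M := (2 * k).+1.
pose mu : {measure set nat -> \bar R} := msum (fun i => \d_i) (2 * M).
have muE A : mu A = (count (mem A) (iota 0 (2 * M)))%:R%:E.
  transitivity (\sum_(i < 2 * M) ((i : nat) \in A)%:R%:E : \bar R)%E;
    first by [].
  rewrite sumEFin -natr_sum; congr (_%:R%:E).
  by rewrite -(big_mkord xpredT (fun i =>
    (i \in A : nat))) -sum1_count [RHS]big_mkcond /index_iota subn0.
have muT : mu setT = (2 * M)%:R%:E.
  rewrite muE (eq_count (a2 := predT)) ?count_predT ?size_iota// => x.
  by rewrite /= in_setT.
have [||Q muQ] := @exists_normalization _ _ _ mu (\d_0%N).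
- by rewrite muT lte_fin ltr0n.
- by rewrite muT ltry.
move=> /(_ Q)[T [TH Tk]]; apply/negP; rewrite -ltNge.
have [s [b [sT sb]]] := tree_eval_singletons TH.
have : (M <= count (mem (error_set evens T)) (iota 0 (2 * M)) + k)%N.
  (* These are the numbers on which the answer [b] is wrong, the even ones having label [true]. *)
  have parity : count (fun n => odd n == b) (iota 0 (2 * M)) = M.
    elim: (M) => // m IH; rewrite mulnS addnC iotaD count_cat IH /=.
    by rewrite add0n oddM/=; case: (b) => /=; rewrite addn1.
  have cs : (count (mem s) (iota 0 (2 * M)) <= k)%N.
    apply: leq_trans (leq_trans sT Tk); rewrite -size_filter.
    apply: uniq_leq_size; first by rewrite filter_uniq// iota_uniq.
    by move=> x; rewrite mem_filter => /andP[].
  rewrite -{1}parity; apply: leq_trans (leq_add (leqnn _) cs).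
  rewrite -count_predUI; apply: leq_trans (leq_addr _ _).
  apply: sub_count => x /= /eqP xb.
  case: (boolP (x \in s)) => [|/sb Tx]; first by rewrite orbT.
  rewrite orbF mem_set// /error_set /= Tx -xb.
  rewrite (_ : (x \in evens) = ~~ odd x); first by case: odd.
  by apply/idP/idP => [/set_mem//|?]; exact/mem_set.
have := muQ (error_set evens T); rewrite muT muE -[Q _]fineK ?fin_num_measure//.
rewrite -EFinM => -[qE] h; rewrite lte_fin.
have : (4 * count (mem (error_set evens T)) (iota 0 (2 * M)) > 2 * M)%N.
  by move: h; rewrite /M; lia.
rewrite -(ltr_nat R) !natrM qE -natrM => h'.
have M0 : 0 < (2 * M)%:R :> R by rewrite ltr0n.
nra.
Qed.

Theorem theorem3 (R : realType) :
  (forall (d : measure_display) (X : measurableType d) (c : set X)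
          (H : set (set X)),
     standing_assumptions R c H ->
     ((VC_dim R H < +oo)%E ->
        exactly_one
          (~ approximable R c H)
          (approximable R c H /\ ~ interpretable R c H)
          (uniformly_interpretable_constant R c H)) /\
     (VC_dim R H = +oo%E ->
        exactly_one
          (~ approximable R c H)
          (approximable R c H /\ ~ interpretable R c H)
          (uniformly_interpretable_log R c H))) /\
  [/\ (exists (d : measure_display) (X : measurableType d) (c : set X)
              (H : set (set X)),
         [/\ standing_assumptions R c H, (VC_dim R H < +oo)%E &
             ~ approximable R c H]),
      (exists (d : measure_display) (X : measurableType d) (c : set X)
              (H : set (set X)),
         [/\ standing_assumptions R c H, (VC_dim R H < +oo)%E &
             approximable R c H /\ ~ interpretable R c H]),
      (exists (d : measure_display) (X : measurableType d) (c : set X)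
              (H : set (set X)),
         [/\ standing_assumptions R c H, (VC_dim R H < +oo)%E &
             uniformly_interpretable_constant R c H]) &
      (exists (d : measure_display) (X : measurableType d) (c : set X)
              (H : set (set X)),
         [/\ standing_assumptions R c H, VC_dim R H = +oo%E &
             uniformly_interpretable_log R c H])].
Proof.
split=> [d X c H [mc mH _]|].
  split=> VC; apply: exactly_one_of_iff.
  - exact: uniformly_interpretable_constant_of_interpretable.
  - by move=> [k /interpretable_of_uniformly].
  - by move=> [k /approximable_of_uniformly].
  - exact: uniformly_interpretable_log_of_interpretable.
  - by move=> [f /interpretable_of_uniformly].
  - by move=> [f /approximable_of_uniformly].
have VC0 : (VC_dim R (@set0 (set nat)) < +oo)%E by exact: VC_dim_subsingletons.
split.
- exists default_measure_display, nat, [set 0%N], set0; split => //.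
    exact: standing_assumptions_nat.
  exact: not_approximable_nat.
- exists default_measure_display, nat, evens, (@singletons nat); split.
  + exact: standing_assumptions_nat.
  + by apply: VC_dim_subsingletons => _ [a _ <-]; exists a.
  + by split; [exact: approximable_evens|exact: not_interpretable_evens].
- exists default_measure_display, nat, set0, set0; split => //.
    exact: standing_assumptions_nat.
  by exists 0%N; exact: uniformly_interpretable_set0.
- exists default_measure_display, nat, set0, setT; split.
  + exact: standing_assumptions_nat.
  + exact: VC_dim_setT_nat.
  + apply: uniformly_interpretable_log_of_interpretable => //.
    exact/interpretable_of_uniformly/uniformly_interpretable_set0.
Qed.
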